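(* Let $\mathcal{C}$ be a clutter on $[n]$ with $\mathcal{C}\neq\{\emptyset\}$. Then $\mathcal{C}$ is tame if and only if $\mathcal{C}$ is a union of some isolated vertices and a complete $d$-partite $d$-uniform clutter, for some positive integer $d$.
   Context: Let $k$ be an algebraically closed field and $R=k[x_1,\ldots,x_n]$. For an ideal $I\subseteq R$, the blowup of $\mathbb{A}^n_k=\mathrm{Spec}(R)$ along $I$ is $\mathrm{Bl}_I(R)=\mathrm{Proj}(\mathcal{R}_R(I))$, where $\mathcal{R}_R(I)=\bigoplus_{i\ge 0}I^it^i\subseteq R[t]$ is the Rees algebra. The ideal $I$ is called tame if $\mathrm{Bl}_I(R)$ is regular. A clutter $\mathcal{C}$ on the vertex set $[n]=\{1,\ldots,n\}$ is a family of subsets of $[n]$, pairwise incomparable under inclusion; its elements are called circuits. It is $d$-uniform if all circuits have cardinality $d$. For $F\subseteq[n]$ put $\mathbf{x}_F=\prod_{i\in F}x_i$. The circuit ideal is $I(\mathcal{C})=(\mathbf{x}_F : F\in\mathcal{C})\subseteq R$, and $\mathcal{C}$ is called tame if $I(\mathcal{C})$ is tame. An isolated vertex of $\mathcal{C}$ is a vertex contained in no circuit. A $d$-uniform clutter ($d\ge 1$) is $d$-partite if its vertex set is the union of mutually disjoint subsets $V_1,\ldots,V_d$ such that each circuit meets each $V_i$ in at most one vertex; it is complete $d$-partite if moreover it contains all $d$-subsets of the vertex set which meet each $V_i$ in at most one vertex. The subsets $V_i$ are not required to be nonempty. 'A union of some isolated vertices and a complete $d$-partite $d$-uniform clutter'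 means: there is a subset $W\subseteq[n]$ containing all circuits of $\mathcal{C}$ (so that all vertices in $[n]\setminus W$ are isolated; possibly $W=[n]$) such that $\mathcal{C}$, viewed as a clutter on the vertex set $W$, is complete $d$-partite and $d$-uniform. *)

(* Defs.v *)
From HB Require Import structures.
From mathcomp Require Import all_boot all_order all_algebra.
From mathcomp Require Import mpoly.
From mathcomp Require Import boolp.

(* Via [asbool] from [boolp], a predicate [{pred A}] is an arbitrary subset of *)
(* A.                                                                          *)

Set Implicit Arguments.
Unset Strict Implicit.
Unset Printing Implicit Defensive.

Import GRing.Theory.
Local Open Scope ring_scope.

Section Ideals.
Variable A : comNzRingType.
Implicit Types (I G : {pred A}).

Definition ideal_gen G : {pred A} := fun x =>
  `[< exists2 s : seq (A * A), all (fun c => c.2 \in G) s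
                             & x = \sum_(c <- s) c.1 * c.2 >].

(* Generated by the products of i elements of I; the unit ideal for i = 0.     *)
Definition ideal_pow I (i : nat) : {pred A} :=
  ideal_gen (fun x => `[< exists2 f : 'I_i -> A, forall j, f j \in I
                                               & x = \prod_j f j >]).

Lemma ideal_genP G x :
  reflect (exists2 s : seq (A * A), all (fun c => c.2 \in G) s
                                  & x = \sum_(c <- s) c.1 * c.2)
          (x \in ideal_gen G).
Proof. exact: asboolP. Qed.

Lemma mem_ideal_gen G x : x \in G -> x \in ideal_gen G.
Proof.
move=> xG; apply/ideal_genP; exists [:: (1, x)]; first by rewrite /= xG.
by rewrite big_seq1 mul1r.
Qed.

Lemma ideal_gen0 G : 0 \in ideal_gen G.
Proof. by apply/ideal_genP; exists [::]; rewrite ?big_nil. Qed.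

Lemma ideal_genD G x y :
  x \in ideal_gen G -> y \in ideal_gen G -> x + y \in ideal_gen G.
Proof.
move=> /ideal_genP[s sG ->] /ideal_genP[t tG ->]; apply/ideal_genP.
by exists (s ++ t); rewrite ?all_cat ?sG // big_cat.
Qed.

Lemma ideal_genMl G a x : x \in ideal_gen G -> a * x \in ideal_gen G.
Proof.
move=> /ideal_genP[s sG ->]; apply/ideal_genP.
exists [seq (a * c.1, c.2) | c <- s]; first by rewrite all_map.
by rewrite big_map mulr_sumr; apply: eq_bigr => c _; rewrite mulrA.
Qed.

Lemma ideal_gen_sum G (T : Type) (r : seq T) (P : pred T) (F : T -> A) :
  (forall i, P i -> F i \in ideal_gen G) ->
  \sum_(i <- r | P i) F i \in ideal_gen G.
Proof.
move=> FG; apply: (big_ind (fun x => x \in ideal_gen G)) => //.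
  exact: ideal_gen0.
by move=> x y; exact: ideal_genD.
Qed.

Lemma ideal_pow0 I x : x \in ideal_pow I 0.
Proof.
rewrite -[x]mulr1; apply: ideal_genMl; apply: mem_ideal_gen; apply/asboolP.
by exists (fun=> 0); [case | rewrite big_ord0].
Qed.

Lemma ideal_powM I i j x y :
  x \in ideal_pow I i -> y \in ideal_pow I j -> x * y \in ideal_pow I (i + j).
Proof.
move=> /ideal_genP[s /allP sG ->] /ideal_genP[t /allP tG ->].
rewrite mulr_suml big_seq; apply: ideal_gen_sum => c /sG cG.
rewrite -mulrA; apply: ideal_genMl.
rewrite mulr_sumr big_seq; apply: ideal_gen_sum => e /tG eG.
rewrite mulrCA; apply: ideal_genMl; apply: mem_ideal_gen.
move: cG eG => /asboolP[f fI ->] /asboolP[g gI ->]; apply/asboolP.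
exists (fun k => match split k with inl a => f a | inr b => g b end).
  by move=> k; case: (split k).
rewrite big_split_ord /=; congr (_ * _); apply: eq_bigr => k _.
  by have := unsplitK (inl k : 'I_i + 'I_j) => /= ->.
by have := unsplitK (inr k : 'I_i + 'I_j) => /= ->.
Qed.

End Ideals.

Section RegularLocalRings.
Variable A : comNzRingType.
Implicit Types (P Q m : {pred A}).

(* The library's [idealr_closed] describes proper ideals. *)
Definition is_prime P := idealr_closed P /\ prime_idealr_closed P.

Definition is_maximal m :=
  idealr_closed m /\
  forall Q, idealr_closed Q -> {subset m <= Q} -> Q =i m.

(* The unit ideal, which [idealr_closed] omits, is generated by 1. *)
Definition noetherian :=
  forall Q, idealr_closed Q -> exists s : seq A, Q =i ideal_gen (mem s).

Definition strict_subpred P Q :=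
  {subset P <= Q} /\ exists2 x, x \in Q & x \notin P.

Definition has_prime_chain (d : nat) :=
  exists2 P : nat -> {pred A},
    forall i, (i <= d)%N -> is_prime (P i)
  & forall i, (i < d)%N -> strict_subpred (P i) (P i.+1).

(* A has Krull dimension exactly d; it fails for every d if dim A is infinite. *)
Definition krull_dim_eq (d : nat) :=
  has_prime_chain d /\ forall e, has_prime_chain e -> (e <= d)%N.

(* A is Noetherian with a unique maximal ideal, generated by dim A elements.   *)
Definition regular_local_ring :=
  noetherian /\
  exists m, [/\ is_maximal m,
                forall m', is_maximal m' -> m' =i m
              & exists d, krull_dim_eq d /\
                  exists s : d.-tuple A, m =i ideal_gen (mem s)].

End RegularLocalRings.

Record grading (S : idomainType) := Grading {
  piece :> nat -> {pred S};
  piece_zmod_closed : forall d, zmod_closed (piece d);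
  piece1 : 1 \in piece 0;
  pieceM : forall d e x y,
    x \in piece d -> y \in piece e -> x * y \in piece (d + e)%N;
  piece_sum : forall x, exists m, exists2 f : 'I_m -> S,
    forall i, f i \in piece i & x = \sum_i f i;
  piece_direct : forall m (f : 'I_m -> S), (forall i, f i \in piece i) ->
    \sum_i f i = 0 -> forall i, f i = 0
}.

Section Proj.
Variables (S : idomainType) (Gr : grading S).

Definition homogeneous_ideal (P : {pred S}) :=
  forall x, x \in P -> exists m, exists2 f : 'I_m -> S,
    forall i, f i \in P /\ f i \in Gr i & x = \sum_i f i.

Record proj_point := ProjPoint {
  point_ideal :> {pred S};
  point_prime : is_prime point_ideal;
  point_homogeneous : homogeneous_ideal point_ideal;
  point_relevant :
    exists d x, [/\ (0 < d)%N, x \in Gr d & x \notin point_ideal]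
}.

(* The local ring of Proj S at P is the degree zero part S_(P) of the          *)
(* localization of S at the homogeneous elements outside P; S being a domain,  *)
(* it is the following subring of the fraction field of S.                     *)
Definition stalk_pred (P : proj_point) : {pred {fraction S}} := fun z =>
  `[< exists d a b, [/\ a \in Gr d, b \in Gr d, b \notin point_ideal P
                      & z = tofrac a / tofrac b] >].

Lemma stalk_predP (P : proj_point) z :
  reflect (exists d a b, [/\ a \in Gr d, b \in Gr d, b \notin point_ideal P
                           & z = tofrac a / tofrac b])
          (z \in stalk_pred P).
Proof. exact: asboolP. Qed.

Lemma point_notin_neq0 (P : proj_point) b :
  b \notin point_ideal P -> tofrac b != 0.
Proof.
have [[P0 _ _] _] := point_prime P.
by apply: contraNneq => /eqP; rewrite tofrac_eq0 => /eqP ->.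
Qed.

Lemma stalk_subring_closed (P : proj_point) : subring_closed (stalk_pred P).
Proof.
have [[P0 P1 _] Pp] := point_prime P.
split=> [|x y|x y].
- apply/stalk_predP; exists 0%N, 1, 1; split=> //; try exact: (piece1 Gr).
  by rewrite tofrac1 divr1.
- move=> /stalk_predP[d [a [b [aG bG bP ->]]]].
  move=> /stalk_predP[e [a' [b' [aG' bG' bP' ->]]]].
  apply/stalk_predP; exists (d + e)%N, (a * b' - a' * b), (b * b'); split.
  + have [_ sub] := piece_zmod_closed Gr (d + e).
    by apply: sub; [exact: pieceM | rewrite addnC; exact: pieceM].
  + exact: pieceM.
  + by apply/negP => /Pp; rewrite (negPf bP) (negPf bP').
  + rewrite tofracB !tofracM -mulNr addf_div ?mulNr //.
      exact: point_notin_neq0 bP.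
    exact: point_notin_neq0 bP'.
- move=> /stalk_predP[d [a [b [aG bG bP ->]]]].
  move=> /stalk_predP[e [a' [b' [aG' bG' bP' ->]]]].
  apply/stalk_predP; exists (d + e)%N, (a * a'), (b * b').
  split; try exact: pieceM.
    by apply/negP => /Pp; rewrite (negPf bP) (negPf bP').
  by rewrite !tofracM mulf_div.
Qed.

HB.instance Definition _ (P : proj_point) :=
  GRing.isSubringClosed.Build {fraction S} (stalk_pred P)
    (stalk_subring_closed P).

Record stalk (P : proj_point) := Stalk {
  stalk_val :> {fraction S};
  _ : stalk_val \in stalk_pred P
}.

HB.instance Definition _ (P : proj_point) :=
  [isSub for @stalk_val P].
HB.instance Definition _ (P : proj_point) :=
  [Choice of stalk P by <:].
HB.instance Definition _ (P : proj_point) :=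
  [SubChoice_isSubComNzRing of stalk P by <:].

(* Every local ring of Proj S is regular; vacuous when Proj S is empty, as for *)
(* the blowup along the zero ideal.                                            *)
Definition proj_regular :=
  forall P : proj_point, regular_local_ring (stalk P).

End Proj.

Section Rees.
Variables (R : idomainType) (I : {pred R}).

Definition rees_pred : {pred {poly R}} := fun p =>
  `[< forall i, p`_i \in ideal_pow I i >].

Lemma rees_predP (p : {poly R}) :
  reflect (forall i, p`_i \in ideal_pow I i) (p \in rees_pred).
Proof. exact: asboolP. Qed.

Lemma rees_predC (c : R) : c%:P \in rees_pred.
Proof.
apply/rees_predP => -[|i]; first exact: ideal_pow0.
by rewrite coefC; exact: ideal_gen0.
Qed.

Lemma rees_predM (p q : {poly R}) :
  p \in rees_pred -> q \in rees_pred -> p * q \in rees_pred.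
Proof.
move=> /rees_predP pI /rees_predP qI; apply/rees_predP => i.
rewrite coefM; apply: ideal_gen_sum => j _.
have ij : (j + (i - j) = i)%N by rewrite subnKC // -ltnS.
by have := ideal_powM (pI j) (qI (i - j)%N); rewrite ij.
Qed.

(* Inverses of units of R[t] are constants, and lie in the Rees algebra. *)
Lemma rees_divring_closed : divring_closed rees_pred.
Proof.
split=> [|p q /rees_predP pI /rees_predP qI|p q pI qI].
- exact: rees_predC.
- apply/rees_predP => i; rewrite coefB -mulN1r.
  by apply: ideal_genD => //; exact: ideal_genMl.
- apply: rees_predM => //.
  case: (boolP (q \is a GRing.unit)) => [|qN]; last by rewrite invr_out.
  rewrite -unitrV poly_unitE => /andP[/size_poly1P[c _ ->] _].
  exact: rees_predC.
Qed.

HB.instance Definition _ :=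
  GRing.isDivringClosed.Build {poly R} rees_pred rees_divring_closed.

Record rees := Rees {
  rees_val :> {poly R};
  _ : rees_val \in rees_pred
}.

HB.instance Definition _ := [isSub for rees_val].
HB.instance Definition _ := [Choice of rees by <:].
HB.instance Definition _ := [SubChoice_isSubIntegralDomain of rees by <:].

Definition rees_piece (d : nat) : {pred rees} := fun p =>
  rees_val p == (rees_val p)`_d *: 'X^d.

Lemma rees_valP (p : rees) i : (rees_val p)`_i \in ideal_pow I i.
Proof. by case: p => p /= /rees_predP. Qed.

Lemma rees_pieceP d (p : rees) :
  reflect (exists c, rees_val p = c *: 'X^d) (p \in rees_piece d).
Proof.
apply: (iffP eqP) => [->|[c ->]]; first by eexists.
by rewrite coefZ coefXn eqxx mulr1.
Qed.

Lemma rees_piece_zmod_closed d : zmod_closed (rees_piece d).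
Proof.
split=> [|p q /rees_pieceP[a pa] /rees_pieceP[b qb]]; apply/rees_pieceP.
  by exists 0; rewrite scale0r -[rees_val]/(val : rees -> _) rmorph0.
exists (a - b); rewrite scalerBl -pa -qb.
by rewrite -[rees_val]/(val : rees -> _) rmorphB.
Qed.

Lemma rees_piece1 : 1 \in rees_piece 0.
Proof.
apply/rees_pieceP; exists 1.
by rewrite -[rees_val]/(val : rees -> _) rmorph1 expr0 scale1r.
Qed.

Lemma rees_pieceM d e (p q : rees) :
  p \in rees_piece d -> q \in rees_piece e -> p * q \in rees_piece (d + e).
Proof.
move=> /rees_pieceP[a pa] /rees_pieceP[b qb]; apply/rees_pieceP.
exists (a * b); rewrite -[rees_val]/(val : rees -> _) rmorphM /= pa qb.
by rewrite -scalerAl -scalerAr scalerA exprD.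
Qed.

Lemma rees_piece_sum (p : rees) : exists m, exists2 f : 'I_m -> rees,
  forall i, f i \in rees_piece i & p = \sum_i f i.
Proof.
have mono i : (rees_val p)`_i *: 'X^i \in rees_pred.
  apply/rees_predP => j; rewrite coefZ coefXn.
  have [->|_] := eqVneq j i; first by rewrite mulr1 rees_valP.
  by rewrite mulr0 ideal_gen0.
exists (size (rees_val p)), (fun i => Rees (mono i)).
  by move=> i; apply/rees_pieceP; eexists.
apply: val_inj; rewrite raddf_sum /=.
by rewrite -[LHS]coefK poly_def.
Qed.

Lemma rees_piece_direct m (f : 'I_m -> rees) :
  (forall i, f i \in rees_piece i) -> \sum_i f i = 0 -> forall i, f i = 0.
Proof.
move=> fG f0 i; apply: val_inj; rewrite rmorph0 /=.
have /(congr1 (fun p : {poly R} => p`_i)) := congr1 val f0.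
rewrite rmorph0 raddf_sum /= coef_sum coef0 (bigD1 i) //= big1 ?addr0.
  by move=> fi0; have /eqP -> := fG i; rewrite fi0 scale0r.
move=> j ji; have /eqP -> := fG j; rewrite coefZ coefXn.
by rewrite -val_eqE eq_sym in ji; rewrite (negPf ji) mulr0.
Qed.

Definition rees_grading : grading rees :=
  Grading rees_piece_zmod_closed rees_piece1 rees_pieceM rees_piece_sum
          rees_piece_direct.

(* The blowup of Spec R along I is Proj of the Rees algebra. *)
Definition tame_ideal := proj_regular rees_grading.

End Rees.

Section Clutters.
Variable n : nat.
Implicit Types (C : {set {set 'I_n}}) (F W : {set 'I_n}).

Definition is_clutter C :=
  forall F G, F \in C -> G \in C -> F \subset G -> F = G.

Definition uniform d C := {in C, forall F, #|F| = d}.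

(* Pairwise disjoint, possibly empty, blocks with union W. *)
Definition disjoint_blocks d (V : 'I_d -> {set 'I_n}) W :=
  (forall i j, i != j -> [disjoint V i & V j]) /\ \bigcup_i V i = W.

Definition meets_at_most_once d (V : 'I_d -> {set 'I_n}) F :=
  forall i, (#|F :&: V i| <= 1)%N.

(* C, as a clutter on the vertex set W, is d-uniform and complete d-partite. *)
Definition complete_dpartite_on d W C :=
  uniform d C /\
  exists V : 'I_d -> {set 'I_n},
    [/\ disjoint_blocks V W,
        {in C, forall F, meets_at_most_once V F}
      & forall F, F \subset W -> #|F| = d -> meets_at_most_once V F -> F \in C].

Definition isolated_union_complete_dpartite d C :=
  exists W, {in C, forall F, F \subset W} /\ complete_dpartite_on d W C.

Definition xmon (k : idomainType) F : {mpoly k[n]} := \prod_(i in F) 'X_i.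

Definition circuit_ideal (k : idomainType) C : {pred {mpoly k[n]}} :=
  ideal_gen (mem [seq xmon k F | F in C]).

Definition tame_clutter (k : idomainType) C := tame_ideal (@circuit_ideal k C).

End Clutters.

(* Main.v *)
(* The chart of the blowup at a circuit F is the spectrum of the monoid algebra *)
(* on the monoid M_F generated by the e_i and the e_G - e_F, for G in C.        *)
(*                                                                              *)
(* If C is complete d-partite with blocks V_i and F = {v_1, ..., v_d}, then M_F *)
(* is free on the e_(v_i), the e_v - e_(v_i) for v in V_i, and the e_v for v    *)
(* isolated, so every stalk is a localization of a polynomial ring.  Such a     *)
(* localization is regular: by induction on the number of variables, a prime P  *)
(* of k[x_1, ..., x_n] is locally generated by d elements, is the end of a      *)
(* chain of length d, and has n - d elements independent modulo P; choosing an  *)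
(* element in each step of a chain of length e below P extends these to         *)
(* n - d + e algebraically independent elements, whence e <= d.                 *)
(*                                                                              *)
(* Conversely F is a vertex of the Newton polyhedron of I(C), so M_F has no     *)
(* nontrivial unit and its nonzero elements span a maximal ideal.  The          *)
(* coefficient at an irreducible element of M_F is a point derivation there, so *)
(* a regular stalk, of dimension at most n, leaves room for at most n           *)
(* irreducible elements.  The e_u for u in F, and for each v outside F the      *)
(* element e_v - e_T with T of maximal size, already are n of them, so they     *)
(* generate M_F.  Hence F \ G is covered by the sets T of the v in G \ F, for   *)
(* all circuits F and G; this forces #T <= 1 and is an exchange property from   *)
(* which the blocks are read off.                                               *)

From HB Require Import structures.
From mathcomp Require Import all_boot all_order all_algebra.
From mathcomp Require Import mpoly.
From mathcomp Require Import boolp ring zify.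
Require Import Defs.

Set Implicit Arguments.
Unset Strict Implicit.
Unset Printing Implicit Defensive.

Import GRing.Theory.
Local Open Scope ring_scope.

(** * Iterated polynomial rings *)

(** A stalk of the blowup at a point of the chart of [F] is a localization of k[M_F], where M_F is
    the exponent monoid generated by the [x_v] and the [x_G / x_F]. Tameness is therefore a question
    about these monoids.

    Partite implies tame. The products of d circuits generate the d-th power of the ideal, so every
    point lies on the chart of some circuit [F] ([relevant_circuit]). By
    [complete_dpartite_exchange], replacing the vertex [rho v] of [F] by a vertex [v] of the same
    block gives a circuit, so [x_v / x_(rho v)] is a function on the chart, and every [x_G / x_F] is
    a product of such quotients. These functions and the remaining variables are n coordinates, so
    the stalk is a localization of a polynomial ring ([partite_chart_regular]). Such a ring is
    regular by [chart_regular]: [tower_prime_gens] gives a prime d local generators, a chain of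
    length d and n - d residues that are algebraically independent, while [chain_indep] and
    [trdeg_bound] forbid longer chains.

    Tame implies partite. Taking the coefficient of [x_F^d] in degree d defines a point of the
    blowup ([vertex_point]). Each irreducible element of M_F yields a point derivation there
    ([tangent_coefM]), and these are independent on the irreducible elements. As the dimension is at
    most n, regularity leaves room for at most n irreducible elements ([irr_bound]). The elements of
    [irr_inner] and [irr_outer] already number n, and [irr_extra] produces another one unless
    [F :\: G] is covered by the sets [tmax C F v] with [v] in [G :\: F] ([vertex_cover]). What
    remains is combinatorial: the covering sets have at most one element ([card_tmax]), so the
    covering becomes a bijective exchange ([circuit_exchange]), whose fibres are the blocks
    ([covered_partite]). *)

Fixpoint tower (k : fieldType) (n : nat) : idomainType :=
  if n is m.+1 then ({poly tower k m} : idomainType) else k.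

Section Tower.
Variables (k : fieldType) (B : comNzRingType) (i : {rmorphism k -> B}).

(** Points are total sequences of which only the first [n] terms are read ([eq_teval]), so a family
    can be lengthened without changing its type. *)
Fixpoint teval (t : nat -> B) (n : nat) : {rmorphism tower k n -> B} :=
  match n return {rmorphism tower k n -> B} with
  | 0 => i
  | m.+1 => horner_morph (fun p => mulrC (t m) (teval t m p))
  end.

Lemma tevalS t n (p : tower k n.+1) :
  teval t n.+1 p = (map_poly (teval t n) p).[t n].
Proof. by []. Qed.

Lemma tevalC t n (c : tower k n) : teval t n.+1 (c%:P : {poly tower k n}) = teval t n c.
Proof. by rewrite tevalS map_polyC hornerC. Qed.

Lemma tevalX t n : teval t n.+1 ('X : {poly tower k n}) = t n.
Proof. by rewrite tevalS map_polyX hornerX. Qed.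

Lemma eq_teval t t' n : (forall j, (j < n)%N -> t j = t' j) ->
  teval t n =1 teval t' n.
Proof.
elim: n => [//|n IHn] tt' p; rewrite !tevalS tt' //; congr (_.[_]).
apply: eq_map_poly; apply: IHn => j jn; apply: tt'; exact: ltnW.
Qed.

End Tower.

(** * Ideals and the Hilbert basis theorem *)

Section IdealClosure.
Variable A : comNzRingType.
Implicit Types (Q G : {pred A}).

(* Unlike the library's [idealr_closed], the unit ideal is allowed. *)
Definition ideal_closed Q :=
  0 \in Q /\ forall a x y, x \in Q -> y \in Q -> a * x + y \in Q.

Lemma idealr_closedW Q : idealr_closed Q -> ideal_closed Q.
Proof. by case=> Q0 _ QP; split=> // a x y; apply: QP. Qed.

Lemma ideal_gen_sub Q G : ideal_closed Q -> {subset G <= Q} ->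
  {subset ideal_gen G <= Q}.
Proof.
move=> [Q0 QP] GQ x /ideal_genP[s /allP sG ->]; rewrite big_seq.
elim/big_rec: _ => // c y cs yQ; apply: QP => //; exact/GQ/sG.
Qed.

Lemma noetherian_ideal : noetherian A -> forall Q, ideal_closed Q ->
  exists s : seq A, Q =i ideal_gen (mem s).
Proof.
move=> nA Q [Q0 QP]; have [Q1|Q1] := boolP (1 \in Q); last first.
  by apply: nA; split=> // a x y; apply: QP.
exists [:: 1] => x; have xQ y : y \in Q by rewrite -[y]mulr1 -[y*1]addr0 QP.
rewrite xQ; apply/esym; rewrite -[x]mulr1; apply: ideal_genMl.
by apply: mem_ideal_gen; rewrite inE.
Qed.

Lemma ideal_closedMl Q a x : ideal_closed Q -> x \in Q -> a * x \in Q.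
Proof. by move=> [Q0 QP] xQ; rewrite -[a * x]addr0; apply: QP. Qed.

Lemma ideal_closedD Q x y : ideal_closed Q -> x \in Q -> y \in Q -> x + y \in Q.
Proof. by move=> [Q0 QP] xQ yQ; rewrite -[x]mul1r QP. Qed.

Lemma ideal_closedB Q x y : ideal_closed Q -> x \in Q -> y \in Q -> x - y \in Q.
Proof.
by move=> QP xQ yQ; rewrite -mulN1r ideal_closedD //; apply: ideal_closedMl.
Qed.

Lemma ideal_closed_sum Q (T : Type) (r : seq T) (P : pred T) (F : T -> A) :
  ideal_closed Q -> (forall i, P i -> F i \in Q) -> \sum_(i <- r | P i) F i \in Q.
Proof.
move=> Qc FQ; elim/big_rec: _ => [|i x Pi xQ]; first by case: Qc.
by apply: ideal_closedD => //; apply: FQ.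
Qed.

End IdealClosure.

Lemma ideal_gen_closed (B : comNzRingType) (G : {pred B}) : ideal_closed (ideal_gen G).
Proof.
split; first exact: ideal_gen0.
by move=> a x y xG yG; apply: ideal_genD => //; exact: ideal_genMl.
Qed.

Lemma rmorph_ideal_gen (B C : comNzRingType) (f : {rmorphism B -> C}) (s : seq B) x :
  x \in ideal_gen (mem s) -> f x \in ideal_gen (mem (map f s)).
Proof.
move=> /ideal_genP[w /allP ws ->]; rewrite rmorph_sum big_seq.
apply: ideal_gen_sum => e /ws es; rewrite rmorphM; apply: ideal_genMl.
exact/mem_ideal_gen/map_f.
Qed.

Lemma ideal_closed_colon (A : comNzRingType) (J : {pred A}) a :
  ideal_closed J -> ideal_closed (fun x => a * x \in J).
Proof.
move=> Jc; split; first by rewrite unfold_in mulr0; case: Jc.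
by move=> b x y xJ yJ; rewrite unfold_in mulrDr mulrCA; case: Jc => _; apply.
Qed.

Lemma ideal_pow1 (A : comNzRingType) (J : {pred A}) x : x \in J -> x \in ideal_pow J 1.
Proof.
move=> xJ; apply: mem_ideal_gen; apply/asboolP; exists (fun=> x) => //.
by rewrite big_ord1.
Qed.

Lemma ideal_gen_tuple (A : comNzRingType) d (s : d.-tuple A) x :
  x \in ideal_gen (mem s) -> exists c : 'I_d -> A, x = \sum_j c j * tnth s j.
Proof.
move=> /ideal_genP[w /allP ws ->]; elim: w ws => [|e w IHw] ws.
  by exists (fun=> 0); rewrite big_nil big1 // => j _; rewrite mul0r.
have [|c cE] := IHw; first by move=> y yw; apply: ws; rewrite inE yw orbT.
have /tnthP[l lE] := ws e (mem_head _ _).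
exists (fun j => (if j == l then e.1 else 0) + c j).
rewrite big_cons cE (eq_bigr _ (fun j _ => mulrDl _ _ _)) big_split; congr (_ + _).
rewrite (bigD1 l) //= eqxx big1 ?addr0 ?lE // => j /negPf->.
by rewrite mul0r.
Qed.

Lemma noetherian_field (k : fieldType) : noetherian k.
Proof.
move=> Q [Q0 Q1 QP]; exists [::] => x; apply/idP/ideal_genP => [xQ|].
  exists [::] => //; rewrite big_nil; apply/eqP; apply: contraNT Q1 => x0.
  by rewrite -(mulVf x0) -[_ * _]addr0 QP.
by case=> -[|c s] //= _ ->; rewrite big_nil.
Qed.

Section HilbertBasis.
Variables (R : comNzRingType) (Q : {pred {poly R}}).
Hypothesis Qc : ideal_closed Q.

(** Bounding the size instead of fixing it admits the coefficient 0 and makes this an ideal. *)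
Definition lead_ideal (d : nat) : {pred R} := fun c =>
  `[< exists2 p : {poly R}, p \in Q & (size p <= d.+1)%N /\ p`_d = c >].

Lemma lead_idealP d c :
  reflect (exists2 p : {poly R}, p \in Q & (size p <= d.+1)%N /\ p`_d = c)
          (c \in lead_ideal d).
Proof. exact: asboolP. Qed.

Lemma lead_ideal_closed d : ideal_closed (lead_ideal d).
Proof.
split; first by apply/lead_idealP; exists 0; rewrite ?size_poly0 ?coef0 //; case: Qc.
move=> a x y /lead_idealP[p pQ [sp <-]] /lead_idealP[q qQ [sq <-]].
apply/lead_idealP; exists (a%:P * p + q); first by case: Qc => _; apply.
split; last by rewrite coefD coefCM.
by rewrite mul_polyC (leq_trans (size_polyD _ _)) // geq_max sq
  (leq_trans (size_scale_leq _ _)).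
Qed.

Lemma lead_ideal_le d e : (d <= e)%N -> {subset lead_ideal d <= lead_ideal e}.
Proof.
move=> de c /lead_idealP[p pQ [sp <-]]; apply/lead_idealP.
exists ('X^(e - d) * p); first exact: ideal_closedMl.
rewrite (leq_trans (size_polyMleq _ _)) ?size_polyXn ?addSn /=; last first.
  by rewrite -{2}(subnK de) -addnS leq_add2l.
by rewrite mulrC coefMXn ltnNge leq_subr /= subKn.
Qed.

End HilbertBasis.

(** Hilbert's argument: the ideals [lead_ideal Q d] increase with [d], and their union is finitely
    generated, so they are constant from some [N] on. Lifts of generators of the first [N.+1] of
    them generate [Q], by cancelling top coefficients. *)
Lemma noetherian_poly (R : comNzRingType) : noetherian R -> noetherian {poly R}.
Proof.
move=> nR Q /idealr_closedW Qc.
have {}nR := noetherian_ideal nR.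
have [s sP] : {s : nat -> seq R & forall d,
    lead_ideal Q d =i ideal_gen (mem (s d))}.
  apply: (@choice _ _ (fun d t => lead_ideal Q d =i ideal_gen (mem t))) => d.
  exact/nR/lead_ideal_closed.
have [f fP] : {f : nat * R -> {poly R} & forall dc,
    dc.2 \in lead_ideal Q dc.1 ->
    [/\ f dc \in Q, (size (f dc) <= dc.1.+1)%N & (f dc)`_dc.1 = dc.2]}.
  apply: (@choice _ _ (fun dc p => dc.2 \in lead_ideal Q dc.1 ->
    [/\ p \in Q, (size p <= dc.1.+1)%N & p`_dc.1 = dc.2])) => -[d c] /=.
  have [/lead_idealP[p pQ [sp pc]]|_] := boolP (c \in lead_ideal Q d).
    by exists p.
  by exists 0.
have [N NP] : exists N, forall d, {subset lead_ideal Q d <= lead_ideal Q N}.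
  pose L : {pred R} := fun c => `[< exists d, c \in lead_ideal Q d >].
  have Lc : ideal_closed L.
    split; first by apply/asboolP; exists 0%N; case: (lead_ideal_closed Qc 0).
    move=> a x y /asboolP[d xd] /asboolP[e ye]; apply/asboolP.
    exists (maxn d e); case: (lead_ideal_closed Qc (maxn d e)) => _; apply.
      exact: (lead_ideal_le Qc (leq_maxl _ _)).
    exact: (lead_ideal_le Qc (leq_maxr _ _)).
  have [t tP] := nR L Lc.
  have [N NP] : exists N, {subset t <= lead_ideal Q N}.
    have : {subset t <= L} by move=> c ct; rewrite tP mem_ideal_gen.
    elim: {tP}t => [|c t IHt] tL; first by exists 0%N.
    have /asboolP[d cd] := tL c (mem_head _ _).
    have [|N tN] := IHt; first by move=> x xt; apply: tL; rewrite inE xt orbT.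
    exists (maxn d N) => x; rewrite inE => /predU1P[->|/tN].
      exact: (lead_ideal_le Qc (leq_maxl _ _)).
    exact: (lead_ideal_le Qc (leq_maxr _ _)).
  exists N => d c cd; apply: (ideal_gen_sub (lead_ideal_closed Qc N) NP).
  by rewrite -tP; apply/asboolP; exists d.
pose G := flatten [seq [seq f (d, c) | c <- s d] | d <- iota 0 N.+1].
have sL d c : c \in s d -> c \in lead_ideal Q d.
  by move=> cs; rewrite sP mem_ideal_gen.
exists G => p; apply/idP/idP; last first.
  apply: ideal_gen_sub => // q /flatten_mapP[d _ /mapP[c /sL cd ->]].
  by case: (fP (d, c) cd).
move: {2}(size p) (leqnn (size p)) => m; elim: m p => [|m IHm] p pm pQ.
  move: pm; rewrite leqn0 size_poly_eq0 => /eqP->; exact: ideal_gen0.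
(* Beyond degree [N] the generators found in degree [N] are reused, shifted by ['X^(m - d)]. *)
pose d := minn m N.
have : p`_m \in lead_ideal Q d.
  have pL : p`_m \in lead_ideal Q m by apply/lead_idealP; exists p.
  by rewrite /d; case: leqP => // _; apply: NP pL.
rewrite sP => /ideal_genP[t /allP tP pmE].
have dm : (d <= m)%N by rewrite geq_minl.
pose q := \sum_(e <- t | e \in t) e.1 *: ('X^(m - d) * f (d, e.2)).
have qm : q`_m = p`_m.
  rewrite pmE coef_sum [RHS]big_seq; apply: eq_bigr => e /tP/sL ed.
  case: (fP (d, e.2) ed) => _ _ /= fe.
  by rewrite coefZ mulrC mulrC ['X^_ * _]mulrC coefMXn ltnNge leq_subr subKn //= fe.
have qG : q \in ideal_gen (mem G).
  apply: ideal_gen_sum => e /tP es; rewrite -mul_polyC mulrA.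
  apply: ideal_genMl; apply: mem_ideal_gen; apply/flatten_mapP; exists d.
    by rewrite mem_iota ltnS geq_minr.
  exact: map_f.
have sq : (size q <= m.+1)%N.
  apply: (big_ind (fun q : {poly R} => size q <= m.+1)%N).
  - by rewrite size_poly0.
  - by move=> u v um vm; rewrite (leq_trans (size_polyD _ _)) // geq_max um.
  move=> e /tP/sL ed; case: (fP (d, e.2) ed) => _ /= sf _.
  rewrite (leq_trans (size_scale_leq _ _)) // (leq_trans (size_polyMleq _ _)) //.
  by rewrite size_polyXn addSn /= -{2}(subnK dm) -addnS leq_add2l.
have qQ : q \in Q.
  apply: ideal_closed_sum => // e /tP/sL ed; case: (fP (d, e.2) ed) => fQ _ _.
  by rewrite -mul_polyC mulrA; apply: ideal_closedMl.
rewrite -[p](subrK q); apply: ideal_genD => //; apply: IHm; last exact: ideal_closedB.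
apply/leq_sizeP => j mj; rewrite coefB; have [->|jm] := eqVneq j m.
  by rewrite qm subrr.
have mj' : (m < j)%N by rewrite ltn_neqAle eq_sym jm.
by rewrite !nth_default ?subr0 // ?(leq_trans sq) // (leq_trans pm).
Qed.

Lemma noetherian_tower (k : fieldType) n : noetherian (tower k n).
Proof. by elim: n => [|n IHn]; [exact: noetherian_field | exact: noetherian_poly]. Qed.

(** * Local generators of the primes of a polynomial ring *)

Section Independence.
Variables (k : fieldType) (B : comNzRingType) (i : {rmorphism k -> B}).

(** Algebraic independence over k of the residues of [t 0], ..., [t (m - 1)] modulo [P]. *)
Definition indep_mod (P : {pred B}) (m : nat) (t : nat -> B) :=
  forall q : tower k m, teval i t m q \in P -> q = 0.

Lemma indep_mod_sub (P P' : {pred B}) m t :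
  {subset P' <= P} -> indep_mod P m t -> indep_mod P' m t.
Proof. by move=> PP' ind q /PP'; apply: ind. Qed.

End Independence.

Lemma rmorph_teval (k : fieldType) (B B' : comNzRingType)
    (i : {rmorphism k -> B}) (i' : {rmorphism k -> B'}) (g : {rmorphism B -> B'})
    (t : nat -> B) n (q : tower k n) :
  g \o i =1 i' -> g (teval i t n q) = teval i' (g \o t) n q.
Proof.
move=> gi; elim: n q => [|n IHn] q; first exact: gi.
rewrite !tevalS -horner_map /= -map_poly_comp; congr (_.[_]).
by apply: eq_map_poly => c /=; rewrite IHn.
Qed.

Fixpoint tconst (k : fieldType) (n : nat) : {rmorphism k -> tower k n} :=
  match n return {rmorphism k -> tower k n} with
  | 0 => idfun
  | m.+1 => (polyC \o tconst k m : {rmorphism k -> {poly tower k m}})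
  end.

Section PolyExtension.
Variables (D : comNzRingType) (Q : {pred D}).

Definition poly_ext : {pred {poly D}} := fun p => `[< forall j, p`_j \in Q >].

Lemma poly_extP (p : {poly D}) : reflect (forall j, p`_j \in Q) (p \in poly_ext).
Proof. exact: asboolP. Qed.

(** As in Gauss's lemma: if [a] and [b] are the least indices where [p] and [q] have a coefficient
    outside [Q], then the coefficient of [p * q] at [a + b] is the product of these two modulo
    [Q]. *)
Lemma poly_ext_prime : is_prime Q -> is_prime poly_ext.
Proof.
move=> [Qi Qp]; have Qc := idealr_closedW Qi; have [Q0 Q1 _] := Qi.
split; first split.
- by apply/poly_extP => j; rewrite coef0.
- by apply/negP => /poly_extP/(_ 0%N); rewrite coef1 eqxx (negPf Q1).
- move=> a p q /poly_extP pQ /poly_extP qQ; apply/poly_extP => j.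
  rewrite coefD; apply: ideal_closedD => //; rewrite coefM.
  by apply: ideal_closed_sum => // l _; apply: ideal_closedMl.
have minN (p : {poly D}) : p \notin poly_ext ->
    exists2 a, p`_a \notin Q & forall b, (b < a)%N -> p`_b \in Q.
  move=> pN; have ex : exists a, p`_a \notin Q.
    apply: contrapT => H; case/negP: pN; apply/poly_extP => j.
    by apply: contrapT => /negP jQ; apply: H; exists j.
  case: (ex_minnP ex) => a aQ amin; exists a => // b ba.
  by apply: contraLR ba => /amin; rewrite -leqNgt.
move=> p q pq; apply/orP; case: (boolP (p \in poly_ext)); first by left.
move=> /minN[a pa amin]; case: (boolP (q \in poly_ext)); first by right.
move=> /minN[b qb bmin]; exfalso.
move/poly_extP/(_ (a + b)%N): pq; rewrite coefM.
have ab : (a < (a + b).+1)%N by rewrite ltnS leq_addr.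
rewrite (bigD1 (Ordinal ab)) //= addKn => H.
have {}H : p`_a * q`_b \in Q.
  rewrite -[_ * _](addrK (\sum_(i < (a + b).+1 | i != Ordinal ab) p`_i * q`_(a + b - i))).
  apply: ideal_closedB => //; apply: ideal_closed_sum => // l.
  rewrite -val_eqE /= neq_ltn => /orP[la|la].
    by rewrite mulrC; apply: ideal_closedMl => //; apply: amin.
  apply: ideal_closedMl => //; apply: bmin.
  by rewrite ltn_subLR ?ltn_add2r // -ltnS.
by move: (Qp _ _ H); rewrite (negPf pa) (negPf qb).
Qed.

End PolyExtension.

(* P is generated by s after localization at P. *)
Definition local_gens (A : comNzRingType) (P : {pred A}) (s : seq A) :=
  {subset s <= P} /\
  forall p, p \in P -> exists2 u, u \notin P & u * p \in ideal_gen (mem s).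

Definition chain_to (A : comNzRingType) (P : {pred A}) (d : nat) :=
  exists2 c : nat -> {pred A}, forall i, (i <= d)%N -> is_prime (c i)
  & (forall i, (i < d)%N -> strict_subpred (c i) (c i.+1)) /\ c d = P.

Lemma is_prime_preim (A B : comNzRingType) (f : {rmorphism A -> B}) (P : {pred B}) :
  is_prime P -> is_prime (fun x => f x \in P).
Proof.
move=> [[P0 P1 Pc] Pp]; split; first split.
- by rewrite unfold_in /= rmorph0.
- by rewrite unfold_in /= rmorph1.
- by move=> a x y; rewrite !unfold_in /= rmorphD rmorphM; apply: Pc.
- by move=> x y; rewrite !unfold_in /= rmorphM; apply: Pp.
Qed.

Lemma is_prime_notinM (A : comNzRingType) (P : {pred A}) x y :
  is_prime P -> x \notin P -> y \notin P -> x * y \notin P.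
Proof. by move=> [_ Pp] xP yP; apply/negP => /Pp; rewrite (negPf xP) (negPf yP). Qed.

Lemma is_prime_notinX (A : comNzRingType) (P : {pred A}) x m :
  is_prime P -> x \notin P -> x ^+ m \notin P.
Proof.
move=> PP xP; elim: m => [|m IHm]; first by case: PP => -[].
by rewrite exprS is_prime_notinM.
Qed.

Section PolyLocalGens.
Variables (D : idomainType) (P : {pred {poly D}}).
Hypothesis PP : is_prime P.
Let Q : {pred D} := fun c => c%:P \in P.

Let QE c : (c \in Q) = (c%:P \in P). Proof. by []. Qed.

Let Qp : is_prime Q. Proof. exact: (@is_prime_preim _ _ polyC P). Qed.

Lemma poly_ext_contract_sub : {subset poly_ext Q <= P}.
Proof.
move=> p /poly_extP pQ; rewrite -[p]coefK poly_def.
apply: ideal_closed_sum => [|j _]; first by case: PP => /idealr_closedW.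
rewrite -mul_polyC mulrC; apply: ideal_closedMl; first by case: PP => /idealr_closedW.
by rewrite -QE.
Qed.

(** Each coefficient has its own denominator outside [Q]; there are finitely many, and their product
    serves for the whole polynomial. *)
Lemma poly_ext_local_gens (s : seq D) (r : {poly D}) :
  (forall p, p \in Q -> exists2 u, u \notin Q & u * p \in ideal_gen (mem s)) ->
  r \in poly_ext Q ->
  exists2 u, u \notin Q & u%:P * r \in ideal_gen (mem (map polyC s)).
Proof.
move=> sg; elim/poly_ind: r => [|r c IHr] /poly_extP rQ.
  by exists 1; [case: Qp => -[] | rewrite mulr0 ideal_gen0].
have [u uQ ug] : exists2 u, u \notin Q & u%:P * r \in ideal_gen (mem (map polyC s)).
  apply: IHr; apply/poly_extP => j.
  by have := rQ j.+1; rewrite coefD coefMX coefC /= addr0.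
have [v vQ vg] : exists2 u, u \notin Q & u * c \in ideal_gen (mem s).
  by apply: sg; have := rQ 0%N; rewrite coefD coefMX coefC /= add0r.
exists (u * v); first exact: is_prime_notinM.
rewrite mulrDr; apply: ideal_genD.
  by rewrite polyCM mulrACA mulrC; apply: ideal_genMl.
rewrite polyCM -mulrA -polyCM; apply: ideal_genMl.
move/ideal_genP: vg => [w /allP ws ->]; rewrite rmorph_sum big_seq.
apply: ideal_gen_sum => e /ws es; rewrite rmorphM; apply: ideal_genMl.
exact/mem_ideal_gen/map_f.
Qed.

(* A polynomial of minimal degree in P but not in Q[x] has its leading          *)
(* coefficient outside Q; pseudo-division by it leaves remainders in Q[x].     *)
Lemma poly_local_gens (s : seq D) : local_gens Q s ->
  {subset P <= poly_ext Q} /\ local_gens P (map polyC s) \/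
  exists g, strict_subpred (poly_ext Q) P /\ local_gens P (g :: map polyC s).
Proof.
move=> [sQ sg]; have Pc : ideal_closed P by case: PP => /idealr_closedW.
have sP : {subset map polyC s <= P} by move=> _ /mapP[c /sQ cQ ->].
have [PQ|PQ] := pselect ({subset P <= poly_ext Q}).
  left; split=> //; split=> // p /PQ /(poly_ext_local_gens sg)[u uQ ug].
  by exists u%:P.
right.
have ex : exists m, `[< exists2 g, g \in P & g \notin poly_ext Q /\ size g = m >].
  apply: contrapT => H; apply: PQ => p pP; apply: contrapT => /negP pQ; apply: H.
  by exists (size p); apply/asboolP; exists p.
case: (ex_minnP ex) => m /asboolP[g gP [gQ gm]] gmin.
have gmin' p : p \in P -> (size p < m)%N -> p \in poly_ext Q.
  move=> pP; apply: contraLR => pQ; rewrite -leqNgt; apply: gmin.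
  by apply/asboolP; exists p.
have g0 : g != 0.
  by apply: contraNneq gQ => ->; apply/poly_extP => j; rewrite coef0; case: Qp => -[].
have m0 : (0 < m)%N by rewrite -gm size_poly_gt0.
have lgQ : lead_coef g \notin Q.
  apply: contra gQ => lQ; pose h := lead_coef g *: 'X^(m.-1).
  have hQ : h \in poly_ext Q.
    apply/poly_extP => j; rewrite coefZ mulrC; apply: ideal_closedMl => //.
    by case: Qp => /idealr_closedW.
  have : g - h \in poly_ext Q.
    apply: gmin'; first by apply: ideal_closedB => //; apply: poly_ext_contract_sub.
    rewrite -(prednK m0) ltnS; apply/leq_sizeP => j; rewrite leq_eqVlt.
    rewrite coefB coefZ coefXn => /predU1P[<-|jm].
      by rewrite eqxx mulr1 lead_coefE gm subrr.
    by rewrite gtn_eqF // mulr0 subr0 nth_default // gm -(prednK m0).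
  move=> ghQ; rewrite -[g](subrK h); apply: ideal_closedD => //.
  by case: (poly_ext_prime Qp) => /idealr_closedW.
exists g; split; first by split; [exact: poly_ext_contract_sub | exists g].
split; first by move=> x; rewrite inE => /predU1P[->|/sP].
move=> p pP; have := Pdiv.Idomain.divp_eq p g.
set r := (X in _ + X) => pE.
have [u uQ ug] : exists2 u, u \notin Q & u%:P * r \in ideal_gen (mem (map polyC s)).
  apply: (poly_ext_local_gens sg); apply: gmin'; last first.
    by rewrite -gm Pdiv.Idomain.ltn_modp.
  rewrite -[r](addKr (p %/ g * g)) -pE addrC.
  by apply: ideal_closedB => //; rewrite -?mul_polyC; apply: ideal_closedMl.
exists (u * lead_coef g ^+ scalp p g)%:P.
  by rewrite -QE is_prime_notinM // is_prime_notinX.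
rewrite polyCM -mulrA [(_ ^+ _)%:P * p]mul_polyC pE mulrDr; apply: ideal_genD.
  by rewrite mulrA; apply/ideal_genMl/mem_ideal_gen/mem_head.
move/ideal_genP: ug => [w /allP ws ->]; rewrite big_seq.
apply: ideal_gen_sum => e /ws es; apply: ideal_genMl.
by apply: mem_ideal_gen; rewrite inE; apply/orP; right.
Qed.

End PolyLocalGens.

(** Induction on the variables through the contraction Q of [P]. If P = Q[x], the generators and the
    chain extend unchanged and x is a new independent residue. Otherwise P strictly contains Q[x],
    which lengthens the chain by one at the price of one more generator, with the same residues. *)
Lemma tower_prime_gens (k : fieldType) n (P : {pred tower k n}) : is_prime P ->
  exists d m, [/\ (m + d)%N = n, chain_to P d,
    exists2 s : seq (tower k n), size s = d & local_gens P s
  & exists t, indep_mod (tconst k n) P m t].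
Proof.
elim: n P => [|n IHn] P PP.
  have P0 p : p \in P -> p = 0.
    move=> pP; apply/eqP; apply: contraLR isT => p0.
    have [[_ /negP P1 _] _] := PP; case: P1; rewrite -(mulVf p0).
    by apply: ideal_closedMl => //; case: PP => /idealr_closedW.
  exists 0%N, 0%N; split => //.
  - by exists (fun=> P).
  - exists [::] => //; split=> // p /P0->; exists 1; first by case: PP => -[].
    by rewrite mulr0 ideal_gen0.
  - by exists (fun=> 0) => q /P0.
pose Q : {pred tower k n} := fun c => (c%:P : {poly tower k n}) \in P.
have Qp : is_prime Q by exact: (@is_prime_preim _ _ polyC P PP).
have [d [m [mdn [c cP [cS cQ]] [s sd sg] [t tQ]]]] := IHn Q Qp.
pose t' j : {poly tower k n} := if (j < m)%N then (t j)%:P else 'X.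
have t'E (q : tower k m) : teval (tconst k n.+1) t' m q =
    (teval (tconst k n) t m q)%:P.
  rewrite (eq_teval _ (t' := polyC \o t)).
    by rewrite -(rmorph_teval (g := polyC) (i := tconst k n)).
  by move=> j jm; rewrite /t' jm.
have chainS i : (i < d)%N -> strict_subpred (poly_ext (c i)) (poly_ext (c i.+1)).
  move=> id; have [sub [x x1 x2]] := cS i id; split.
    by move=> p /poly_extP pc; apply/poly_extP => j; apply: sub.
  have [[c0 _ _] _] := cP i.+1 id.
  exists x%:P; first by apply/poly_extP => j; rewrite coefC; case: ifP.
  by apply/negP => /poly_extP/(_ 0%N); rewrite coefC (negPf x2).
have [[PQ sgP]|[g [gP sgP]]] := poly_local_gens PP sg.
  exists d, m.+1; split.
  - by rewrite addSn mdn.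
  (* [poly_ext (c d)] has the same elements as [P], but [chain_to] asks that the last term be [P]
     itself. *)
  - exists (fun i => if (i < d)%N then poly_ext (c i) else P).
      by move=> i id; case: ifP => // _; apply/poly_ext_prime/cP.
    split; last by rewrite ltnn.
    move=> i id; rewrite id; case: ifP => [_|]; first exact: chainS.
    move=> /negbT; rewrite -leqNgt => di.
    have [sub [x x1 x2]] := chainS i id; have ed : i.+1 = d by apply/eqP; rewrite eqn_leq id.
    rewrite ed cQ in sub x1; split; last first.
      by exists x => //; apply: poly_ext_contract_sub x1.
    by move=> p /sub; apply: poly_ext_contract_sub.
  - by exists (map polyC s); rewrite ?size_map.
  exists t' => q; rewrite tevalS {2}/t' ltnn.
  rewrite (eq_map_poly t'E) [X in X.[_]](map_poly_comp (polyC : {rmorphism _ -> _})).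
  move=> qP; have {qP} : map_poly (teval (tconst k n) t m) q \in P.
    by rewrite -[X in X \in _]comp_polyXr.
  move=> /PQ/poly_extP qQ; apply/polyP => j; rewrite coef0; apply: tQ.
  by have := qQ j; rewrite coef_map.
exists d.+1, m; split.
- by rewrite addnS mdn.
- exists (fun i => if (i <= d)%N then poly_ext (c i) else P).
    by move=> i id; case: ifP => // id'; apply/poly_ext_prime/cP.
  split; last by rewrite ltnn.
  move=> i id; rewrite -ltnS id; case: ifP => [id'|]; first exact: chainS.
  move=> /negbT; rewrite -leqNgt => di.
  have -> : i = d by apply/eqP; rewrite eqn_leq di -ltnS id.
  by rewrite cQ.
- by exists (g :: map polyC s); rewrite //= size_map sd.
by exists t' => q; rewrite t'E => qP; apply: tQ.
Qed.

(** * Transcendence degree *)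

(** The new element is some [x] in [Q] outside [P]. In a relation modulo [P], the term free of [x]
    lies in [Q], hence vanishes by independence there; then [x] can be cancelled modulo the prime
    [P], and the degree in [x] drops. *)
Lemma indep_mod_cons (k : fieldType) (B : comNzRingType) (i : {rmorphism k -> B})
    (P Q : {pred B}) m t : is_prime P -> ideal_closed Q -> strict_subpred P Q ->
  indep_mod i Q m t -> exists t', indep_mod i P m.+1 t'.
Proof.
move=> PP Qc [PQ [x xQ xP]] tQ; exists (fun j => if (j < m)%N then t j else x).
have Pc : ideal_closed P by case: PP => /idealr_closedW.
elim/poly_ind => [|r c IHr] //; rewrite tevalS ltnn.
rewrite rmorphD rmorphM /= map_polyX map_polyC /= !hornerE.
rewrite (@eq_teval _ _ _ _ t) => [rcP|j ->] //.
have c0 : c = 0.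
  apply: tQ; have := PQ _ rcP; set y := _ * x => ycQ.
  rewrite -[teval _ _ _ _](addKr y) addrC.
  by apply: ideal_closedB => //; apply: ideal_closedMl.
move: rcP; rewrite c0 rmorph0 addr0 => rxP; rewrite (IHr _) ?mul0r ?add0r //.
case: PP => _ /(_ _ _ rxP); rewrite (negPf xP) orbF.
by rewrite tevalS ltnn.
Qed.

Lemma chain_indep (k : fieldType) (B : comNzRingType) (i : {rmorphism k -> B})
    (c : nat -> {pred B}) e m t :
  (forall j, (j <= e)%N -> is_prime (c j)) ->
  (forall j, (j < e)%N -> strict_subpred (c j) (c j.+1)) ->
  indep_mod i (c e) m t -> exists t', indep_mod i (c 0%N) (m + e) t'.
Proof.
move=> cP cS te; suff H j : (j <= e)%N -> exists t', indep_mod i (c (e - j)%N) (m + j) t'.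
  by have := H e (leqnn e); rewrite subnn.
elim: j => [|j IHj] je; first by rewrite subn0 addn0; exists t.
have [t' t'P] := IHj (ltnW je); rewrite addnS.
have ej : (e - j = (e - j.+1).+1)%N by rewrite -subSn // subSS.
apply: indep_mod_cons t'P.
- exact/cP/leq_subr.
- by case: (cP _ (leq_subr j e)) => /idealr_closedW.
- by rewrite ej; apply: cS; rewrite -ej leq_subr.
Qed.

Section TrdegBound.
Variables (k : fieldType) (n : nat) (K : idomainType).
Variables (iK : {rmorphism k -> K}) (phi : {rmorphism {mpoly k[n]} -> K}).
Hypothesis phi_inj : injective phi.
Hypothesis phiC : forall c, phi c%:MP = iK c.

Section Monomials.
Variables (t : nat -> K) (h : {mpoly k[n]}) (g : nat -> {mpoly k[n]}) (N : nat).

(* Exponent lists start with the exponent of the last variable. *)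
Fixpoint expos (m : nat) : seq (seq nat) :=
  if m is p.+1 then [seq j :: s | j <- iota 0 N, s <- expos p] else [:: [::]].

Fixpoint tmon (m : nat) (s : seq nat) : K :=
  if m is p.+1 then t p ^+ head 0%N s * tmon p (behead s) else 1.

(** The numerator of the monomial [tmon m s] in the fractions [g j / h] over the common denominator
    [h ^+ (m * N)]; see [phi_gmon]. *)
Fixpoint gmon (m : nat) (s : seq nat) : {mpoly k[n]} :=
  if m is p.+1 then g p ^+ head 0%N s * h ^+ (N - head 0%N s) * gmon p (behead s)
  else 1.

Fixpoint tower_of (m : nat) (c : seq nat -> k) : tower k m :=
  match m return tower k m with
  | 0 => c [::]
  | p.+1 => \poly_(j < N) tower_of p (fun s => c (j :: s))
  end.

Lemma size_expos m : size (expos m) = (N ^ m)%N.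
Proof. by elim: m => //= m IHm; rewrite size_allpairs size_iota IHm expnS. Qed.

Lemma uniq_expos m : uniq (expos m).
Proof.
elim: m => //= m IHm; apply: allpairs_uniq => //; first exact: iota_uniq.
by move=> [a s] [b u] _ _ /= [-> ->].
Qed.

Lemma tower_of_eq0 m c : tower_of m c = 0 -> {in expos m, forall s, c s = 0}.
Proof.
elim: m c => [|m IHm] c /=; first by move=> c0 s; rewrite inE => /eqP->.
move=> /polyP c0 s /allpairsP[[j u] /= [jN um ->]].
apply: (IHm (fun s => c (j :: s))) => //.
by have := c0 j; rewrite coef_poly coef0; move: jN; rewrite mem_iota /= => ->.
Qed.

Lemma teval_tower_of m c :
  teval iK t m (tower_of m c) = \sum_(s <- expos m) iK (c s) * tmon m s.
Proof.
elim: m c => [|m IHm] c; first by rewrite /= big_seq1 mulr1.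
rewrite tevalS /= poly_def rmorph_sum horner_sum big_allpairs_dep /=.
rewrite -[in RHS](subn0 N) -/(index_iota 0 N) big_mkord; apply: eq_bigr => j _.
rewrite -mul_polyC rmorphM /= map_polyC map_polyXn hornerM hornerC hornerXn.
apply: etrans (congr1 (fun x => x * _) (IHm _)) _; rewrite mulr_suml; apply: eq_bigr => s _.
by rewrite -mulrA [tmon _ _ * _]mulrC.
Qed.

Lemma phi_gmon m s : (forall j, (j < m)%N -> phi h * t j = phi (g j)) ->
  s \in expos m -> phi (gmon m s) = phi h ^+ (m * N) * tmon m s.
Proof.
elim: m s => [|m IHm] s tg /=; first by rewrite rmorph1 mul0n mulr1.
move=> /allpairsP[[j u] /= [jN um ->]] /=.
rewrite !rmorphM !rmorphXn /= -tg // IHm // => [|l lm]; last exact/tg/ltnW.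
move: jN; rewrite mem_iota /= add0n => /ltnW jN.
rewrite exprMn mulSn exprD -{3}(subnKC jN) exprD.
by rewrite -!mulrA; congr (_ * _); rewrite mulrCA; congr (_ * _); rewrite mulrCA.
Qed.

Lemma msize_gmon (D m : nat) s : (msize h <= D.+1)%N ->
  (forall j, (j < m)%N -> (msize (g j) <= D.+1)%N) ->
  s \in expos m -> (msize (gmon m s) <= (m * N * D).+1)%N.
Proof.
have msM a b (p q : {mpoly k[n]}) : (msize p <= a.+1)%N -> (msize q <= b.+1)%N ->
    (msize (p * q) <= (a + b).+1)%N.
  move=> pa qb; have [->|p0] := eqVneq p 0; first by rewrite mul0r msize0.
  have [->|q0] := eqVneq q 0; first by rewrite mulr0 msize0.
  by rewrite msizeM // -subn1 leq_subLR add1n -addSn -addnS leq_add.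
have msX a j (p : {mpoly k[n]}) : (msize p <= a.+1)%N -> (msize (p ^+ j) <= (j * a).+1)%N.
  by move=> pa; elim: j => [|j IHj]; rewrite ?msize1 // exprS mulSn msM.
move=> hD; elim: m s => [|m IHm] s gD /=; first by rewrite msize1.
move=> /allpairsP[[j u] /= [jN um ->]] /=.
move: jN; rewrite mem_iota /= add0n => /ltnW jN.
rewrite mulSn mulnDl msM // ?IHm // => [|l lm]; last exact/gD/ltnW.
by rewrite -{2}(subnKC jN) mulnDl msM // msX // gD.
Qed.

End Monomials.

Lemma card_bmultinom b : (#|{: 'X_{1..n < b}}| <= b ^ n)%N.
Proof.
have mb (m : 'X_{1..n < b}) (j : 'I_n) : (m j < b)%N.
  rewrite (leq_ltn_trans _ (bmdeg m)) // mdegE.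
  by rewrite (bigD1 j) //= leq_addr.
pose F (m : 'X_{1..n < b}) := [ffun j => Ordinal (mb m j)].
have Finj : injective F.
  move=> m m' /ffunP FF; apply/val_inj/mnmP => j.
  by have := congr1 val (FF j); rewrite !ffunE.
by have := leq_card F Finj; rewrite card_ffun !card_ord.
Qed.

(* Counting: once denominators are cleared, the N^m monomials with exponents    *)
(* below N in m elements have degree O(N), in a space of dimension O(N^n).      *)
Lemma trdeg_bound (t : nat -> K) m :
  (forall j, (j < m)%N -> exists2 h, h != 0 & exists g, phi h * t j = phi g) ->
  indep_mod iK (pred1 0) m t -> (m <= n)%N.
Proof.
move=> tgh tind; rewrite leqNgt; apply/negP => nm.
have [h [h0 [g hg]]] : exists h, h != 0 /\ exists g, 
    forall j, (j < m)%N -> phi h * t j = phi (g j).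
  elim: {tind nm}m tgh => [|m IHm] tgh.
    by exists 1; split; [exact: oner_neq0 | exists (fun=> 0)].
  have [j jm|h [h0 [g hg]]] := IHm; first exact/tgh/ltnW.
  have [h' h'0 [g' hg']] := tgh m (leqnn _).
  exists (h * h'); split; first by rewrite mulf_neq0.
  exists (fun j => if (j < m)%N then h' * g j else h * g') => j; rewrite ltnS.
  case: ltnP => [jm _|mj jm].
    by rewrite [phi (h * _)]rmorphM [phi (h' * _)]rmorphM -hg // mulrAC mulrC mulrA.
  have -> : j = m by apply/eqP; rewrite eqn_leq jm.
  by rewrite !rmorphM -hg' mulrA.
have [D hD gD] : exists2 D, (msize h <= D.+1)%N &
    forall j, (j < m)%N -> (msize (g j) <= D.+1)%N.
  exists (msize h + \sum_(j < m) msize (g j))%N; first by rewrite leqW // leq_addr.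
  move=> j jm; rewrite leqW // (bigD1 (Ordinal jm)) //= addnCA leq_addr //.
(* The numerators have degree below [b]. Since b <= a N and a^n < N, one gets b^n <= a^n N^n <
   N^(n+1) <= N^m, so they outnumber the available monomials and are linearly dependent. *)
pose a := (m * D).+1; pose N := (a ^ n).+1; pose b := (m * N * D).+1.
pose u s := gmon h g N m s.
pose E := expos N m.
have EM : (#|{: 'X_{1..n < b}}| < size E)%N.
  rewrite size_expos (leq_ltn_trans (card_bmultinom b)) //.
  have bN : (b <= a * N)%N.
    by rewrite /a mulSn /b -addn1 addnC leq_add // mulnAC.
  have bNX e : (b ^ e <= (a * N) ^ e)%N.
    by elim: e => // e IHe; rewrite !expnS leq_mul.
  rewrite (leq_ltn_trans (bNX n)) // expnMn.
  rewrite (leq_trans _ (leq_pexp2l _ nm)) // expnS.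
  by rewrite ltn_pmul2r ?expn_gt0.
pose U : 'M[k]_(size E, #|{: 'X_{1..n < b}}|) :=
  \matrix_(i < size E, j < #|{: 'X_{1..n < b}}|)
    (u (nth [::] E i))@_(bmnm (enum_val j)).
have : kermx U != 0.
  apply: contraTneq EM => kU; have := mxrank_ker U; rewrite kU mxrank0.
  move/esym/eqP; rewrite subn_eq0 => UE; rewrite -leqNgt (leq_trans UE) //.
  exact: rank_leq_col.
move=> /matrix0Pn[i0 [i1 Ui]].
(* A nonzero row of the kernel, read as coefficients on exponent lists; the default [i1] is reached
   only for lists outside [E]. *)
pose c s := kermx U i0 (insubd i1 (index s E)).
have csum : \sum_(s <- E) c s *: u s = 0.
  apply/mpolyP => mo; rewrite mcoeff0.
  have [mob|mob] := ltnP (mdeg mo) b; last first.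
    rewrite raddf_sum /= big_seq big1 // => s sE; rewrite mcoeffZ.
    rewrite (memN_msupp_eq0 (m := mo)) ?mulr0 //; apply: msize_mdeg_ge.
    by rewrite (leq_trans _ mob) // msize_gmon.
  have := mulmx_ker U => /matrixP/(_ i0 (enum_rank (BMultinom mob))).
  rewrite [LHS]mxE [RHS]mxE => U0; apply: etrans U0.
  rewrite raddf_sum /= (big_nth [::]) big_mkord.
  apply: eq_bigr => i _; rewrite mcoeffZ [U _ _]mxE enum_rankK /c.
  rewrite index_uniq ?uniq_expos //; congr (kermx U _ _ * _).
  by apply: val_inj; rewrite val_insubd ltn_ord.
have c0 : tower_of N m c = 0.
  apply: tind; rewrite teval_tower_of inE; apply/eqP.
  have ph0 : phi h ^+ (m * N) != 0.
    by rewrite expf_neq0 // -(rmorph0 phi) (inj_eq phi_inj).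
  apply: (mulfI ph0); rewrite mulr0 mulr_sumr.
  transitivity (phi (\sum_(s <- E) c s *: u s)); last by rewrite csum rmorph0.
  rewrite rmorph_sum big_seq [RHS]big_seq; apply: eq_bigr => s sE.
  by rewrite -mul_mpolyC rmorphM phiC (phi_gmon hg sE) mulrCA.
have := tower_of_eq0 c0 (mem_nth [::] (ltn_ord i1)).
rewrite /c index_uniq ?uniq_expos //.
have -> : insubd i1 (i1 : nat) = i1 by apply: val_inj; rewrite val_insubd ltn_ord.
by move/eqP; rewrite (negPf Ui).
Qed.

End TrdegBound.

(** * Localizations of polynomial rings are regular *)

Section LocalRings.
Variable A : comNzRingType.

Definition nonunits : {pred A} := fun x => `[< forall y, x * y <> 1 >].

Lemma nonunitsPn x : reflect (exists y, x * y = 1) (x \notin nonunits).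
Proof.
apply: (iffP negP) => [xN|[y xy] /asboolP/(_ y)//].
by apply: contrapT => H; apply: xN; apply/asboolP => y xy; apply: H; exists y.
Qed.

Lemma proper_sub_nonunits (Q : {pred A}) : idealr_closed Q -> {subset Q <= nonunits}.
Proof.
move=> Qi x xQ; apply: contraT => /nonunitsPn[y xy].
case: (Qi) => _ /negP[]; rewrite -xy mulrC.
by apply: ideal_closedMl => //; exact: idealr_closedW.
Qed.

Lemma nonunits_prime : prime_idealr_closed nonunits.
Proof.
move=> u v uv; apply: contraLR uv.
rewrite negb_or => /andP[/nonunitsPn[x ux] /nonunitsPn[y vy]].
by apply/nonunitsPn; exists (x * y); rewrite mulrACA ux vy mulr1.
Qed.

Lemma unit_mul_mem (Q : {pred A}) b z : ideal_closed Q ->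
  b \notin nonunits -> b * z \in Q -> z \in Q.
Proof.
move=> Qc /nonunitsPn[y by1] bzQ; rewrite -[z]mul1r -by1 mulrAC mulrC.
exact: ideal_closedMl.
Qed.

Hypothesis nonunits_ideal : idealr_closed nonunits.

Lemma nonunits_maximal : is_maximal nonunits.
Proof.
split=> // Q Qi NQ x; apply/idP/idP; last exact: NQ.
exact: proper_sub_nonunits.
Qed.

Lemma nonunits_unique m : is_maximal m -> m =i nonunits.
Proof.
move=> [mi mmax] x; apply/esym/mmax => //; exact: proper_sub_nonunits.
Qed.

End LocalRings.

Arguments nonunits A : clear implicits.

Section RegularChart.
Variables (k : fieldType) (n : nat) (A : comNzRingType).
Variables (i : {rmorphism k -> A}) (phi : {rmorphism tower k n -> A}).
Hypothesis phiC : phi \o tconst k n =1 i.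
Hypothesis phi_inj : injective phi.
Hypothesis localA : idealr_closed (nonunits A).
Hypothesis phi_frac : forall z, exists a b,
  phi b \notin nonunits A /\ phi b * z = phi a.
Hypothesis trdegA : forall m t, indep_mod i (pred1 0) m t -> (m <= n)%N.

Let P0 : {pred tower k n} := fun a => phi a \in nonunits A.

Let P0E a : (a \in P0) = (phi a \in nonunits A). Proof. by []. Qed.

Let P0_prime : is_prime P0.
Proof. by apply: is_prime_preim; split=> //; exact: nonunits_prime. Qed.

Let phi_notinM a b : phi a \notin nonunits A -> phi b \notin nonunits A ->
  phi (a * b) \notin nonunits A.
Proof. by rewrite -!P0E; exact: is_prime_notinM. Qed.

Lemma chart_noetherian : noetherian A.
Proof.
move=> Q /idealr_closedW Qc; have [Q0 QP] := Qc.
pose Q' : {pred tower k n} := fun a => phi a \in Q.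
have [|s sP] := noetherian_ideal (@noetherian_tower k n) (Q := Q').
  split; first by rewrite unfold_in /= rmorph0.
  by move=> a x y xQ yQ; rewrite unfold_in /= rmorphD rmorphM; apply: QP.
exists (map phi s) => z; apply/idP/idP; last first.
  apply: ideal_gen_sub => // _ /mapP[a as_ ->].
  by have : a \in Q' by rewrite sP mem_ideal_gen.
move=> zQ; have [a [b [bN bz]]] := phi_frac z.
apply: (unit_mul_mem (@ideal_gen_closed _ _) bN).
rewrite bz; apply: rmorph_ideal_gen; rewrite -sP unfold_in /= -bz.
exact: ideal_closedMl.
Qed.

Section Extension.
Variable Q : {pred tower k n}.
Hypotheses (Qp : is_prime Q) (QP0 : {subset Q <= P0}).

(** The extension of [Q] to the localization, written with explicit fractions. *)
Definition chart_ext : {pred A} := fun z =>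
  `[< exists a b, [/\ phi b \notin nonunits A, phi b * z = phi a & a \in Q] >].

Lemma chart_ext_phi a : (phi a \in chart_ext) = (a \in Q).
Proof.
apply/asboolP/idP => [[a' [b [bN ba a'Q]]]|aQ]; last first.
  exists a, 1; split=> //; rewrite rmorph1 ?mul1r //.
  by apply/nonunitsPn; exists 1; rewrite mulr1.
have {}ba : b * a = a' by apply: phi_inj; rewrite rmorphM.
case: Qp => _ /(_ b a); rewrite ba a'Q => /(_ isT)/orP[/QP0|//].
by rewrite P0E (negPf bN).
Qed.

Lemma chart_ext_prime : is_prime chart_ext.
Proof.
have Qc : ideal_closed Q by case: Qp => /idealr_closedW.
have [[Q0 Q1 _] Qpr] := Qp; split; first split.
- by rewrite -(rmorph0 phi) chart_ext_phi.
- by rewrite -(rmorph1 phi) chart_ext_phi.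
- move=> x y z /asboolP[a1 [b1 [b1N b1y a1Q]]] /asboolP[a2 [b2 [b2N b2z a2Q]]].
  have [a3 [b3 [b3N b3x]]] := phi_frac x; apply/asboolP.
  exists (a3 * b2 * a1 + b1 * b3 * a2), (b1 * b2 * b3); split.
  + by do !apply: phi_notinM.
  + by rewrite rmorphD !rmorphM -b1y -b2z -b3x; ring.
  + by apply: ideal_closedD => //; apply: ideal_closedMl.
move=> u v /asboolP[a [b [bN bz aQ]]].
have [a1 [b1 [b1N b1u]]] := phi_frac u; have [a2 [b2 [b2N b2v]]] := phi_frac v.
have E : b * (a1 * a2) = b1 * b2 * a.
  apply: phi_inj; by rewrite !rmorphM -b1u -b2v -bz; ring.
have : b * (a1 * a2) \in Q by rewrite E; apply: ideal_closedMl.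
move/Qpr => /orP[/QP0|/Qpr/orP[aQ'|aQ']]; first by rewrite P0E (negPf bN).
- by apply/orP; left; apply/asboolP; exists a1, b1.
- by apply/orP; right; apply/asboolP; exists a2, b2.
Qed.

End Extension.

(** [A] is the localization of the polynomial ring at the prime [P0], so local generators of [P0]
    and the chain below it carry over. Conversely, the m elements independent modulo [P0] are
    independent modulo the top of any chain in [A]; a chain of length e extends them to m + e
    independent elements, whence m + e <= n = m + d. *)
Lemma chart_regular : regular_local_ring A.
Proof.
split; first exact: chart_noetherian.
have [d [m [mdn [c cP [cS cd]] [s sd [sP0 sg]] [t tP]]]] := tower_prime_gens P0_prime.
have cP0 j : (j <= d)%N -> {subset c j <= P0}.
  move=> jd; rewrite -(subKn jd); elim: (d - j)%N => [|l IHl]; first by rewrite subn0 cd.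
  have [ld|ld] := ltnP l d; last first.
    by move: ld IHl; rewrite -subn_eq0 subnS => /eqP->.
  have dl : (0 < d - l)%N by rewrite subn_gt0.
  have [|sub _] := cS (d - l).-1; first by rewrite prednK // leq_subr.
  by rewrite subnS => x /sub; rewrite prednK //; apply: IHl.
exists (nonunits A); split.
- exact: nonunits_maximal.
- by move=> m' /(nonunits_unique localA).
exists d; split; last first.
  have sdt : size (map phi s) == d by rewrite size_map sd.
  exists (Tuple sdt) => z; apply/idP/idP => /=; last first.
    apply: ideal_gen_sub; first exact: idealr_closedW.
    by move=> _ /mapP[a /sP0 aP0 ->].
  move=> zN; have [a [b [bN bz]]] := phi_frac z.
  apply: (unit_mul_mem (@ideal_gen_closed _ _) bN); rewrite bz.
  have [|u uP0 ug] := sg a.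
    by rewrite P0E -bz; apply: ideal_closedMl => //; exact: idealr_closedW.
  apply: (unit_mul_mem (@ideal_gen_closed _ _) uP0).
  by rewrite -rmorphM; apply: rmorph_ideal_gen.
split.
  exists (fun j => chart_ext (c j)) => j jd.
    exact: (chart_ext_prime (cP j jd) (cP0 j jd)).
  have [sub [x x1 x2]] := cS j jd; split.
    by move=> z /asboolP[a [b [bN bz /sub aQ]]]; apply/asboolP; exists a, b.
  exists (phi x); rewrite chart_ext_phi //; first exact: cP.
  - exact: cP0.
  - exact/cP/ltnW.
  - exact/cP0/ltnW.
move=> e [c' c'P c'S].
have [|t' t'P] := chain_indep (i := i) (m := m) (t := phi \o t) c'P c'S.
  move=> q; rewrite -(rmorph_teval (g := phi) t q phiC) => qN; apply: tP.
  by apply: (proper_sub_nonunits (c'P e (leqnn e)).1).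
rewrite -(leq_add2l m) mdn; apply: (trdegA (t := t')).
apply: indep_mod_sub t'P => x; rewrite inE => /eqP->.
by case: (c'P 0%N isT) => -[].
Qed.

End RegularChart.

(** * Stalks of a blowup *)

Section ProjStalk.
Variables (S : idomainType) (Gr : grading S) (P : proj_point Gr).
Local Notation A := (stalk P).

Lemma stalk_frac (z : A) : exists d a b, [/\ a \in Gr d, b \in Gr d,
  b \notin point_ideal P & val z = tofrac a / tofrac b].
Proof. by case: z => z zP; apply/stalk_predP. Qed.

Lemma stalk_of_frac d a b : a \in Gr d -> b \in Gr d -> b \notin point_ideal P ->
  exists z : A, val z = tofrac a / tofrac b.
Proof.
move=> aG bG bP; have zP : tofrac a / tofrac b \in stalk_pred P.
  by apply/stalk_predP; exists d, a, b.
by exists (Stalk zP).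
Qed.

Lemma point_ideal_closed : ideal_closed (point_ideal P).
Proof. by case: (point_prime P) => /idealr_closedW. Qed.

Lemma tofrac_div_eq (a b a' b' : S) : tofrac b != 0 -> tofrac b' != 0 ->
  tofrac a / tofrac b = tofrac a' / tofrac b' -> a * b' = a' * b.
Proof.
move=> b0 b'0 /eqP; rewrite eqr_div // -!tofracM => /eqP E.
by apply/eqP; rewrite -tofrac_eq E.
Qed.

Lemma stalk_nonunitE d a b (z : A) : a \in Gr d -> b \in Gr d ->
  b \notin point_ideal P -> val z = tofrac a / tofrac b ->
  (z \in nonunits A) = (a \in point_ideal P).
Proof.
move=> aG bG bP zE; apply/idP/idP => [zN|aP].
  apply: contraLR zN => aP; apply/nonunitsPn.
  have [w wE] := stalk_of_frac bG aG aP; exists w; apply: val_inj.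
  rewrite rmorphM rmorph1 /= zE wE.
  by rewrite mulf_div [X in _ / X]mulrC divff // mulf_neq0 // (point_notin_neq0 (P := P)).
apply/asboolP => w zw; have [e [a' [b' [aG' bG' bP' wE]]]] := stalk_frac w.
have := congr1 val zw; rewrite rmorphM rmorph1 /= zE wE mulf_div.
have b0 := point_notin_neq0 bP; have b0' := point_notin_neq0 bP'.
rewrite -[RHS](divff (oner_neq0 _)) -tofrac1 -!tofracM.
move=> /tofrac_div_eq; rewrite tofracM mulf_neq0 // tofrac1 oner_neq0 mulr1 mul1r.
move=> /(_ isT isT) E; have := is_prime_notinM (point_prime P) bP bP'.
by rewrite -E mulrC ideal_closedMl //; exact: point_ideal_closed.
Qed.

Lemma stalk_local : idealr_closed (nonunits A).
Proof.
have GM := @pieceM S Gr; have GD e x y : x \in Gr e -> y \in Gr e -> x + y \in Gr e.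
  have [G0 GB] := piece_zmod_closed Gr e => xG yG.
  by rewrite -[y]opprK GB // -[- y]sub0r GB.
split.
- rewrite (@stalk_nonunitE 0 0 1).
  + by case: point_ideal_closed.
  + by case: (piece_zmod_closed Gr 0).
  + exact: (piece1 Gr).
  + by case: (point_prime P) => -[].
  by rewrite rmorph0 tofrac0 mul0r.
- by apply/nonunitsPn; exists 1; rewrite mulr1.
move=> u x y xN yN.
have [d3 [a3 [b3 [a3G b3G b3P uE]]]] := stalk_frac u.
have [d1 [a1 [b1 [a1G b1G b1P xE]]]] := stalk_frac x.
have [d2 [a2 [b2 [a2G b2G b2P yE]]]] := stalk_frac y.
rewrite (stalk_nonunitE a1G b1G b1P xE) in xN.
rewrite (stalk_nonunitE a2G b2G b2P yE) in yN.
rewrite (@stalk_nonunitE (d3 + d1 + d2) (a3 * a1 * b2 + a2 * (b3 * b1)) (b3 * b1 * b2)).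
- have Pc := point_ideal_closed; apply: ideal_closedD => //.
    by rewrite mulrAC; apply: ideal_closedMl.
  by rewrite mulrC; apply: ideal_closedMl.
- apply: GD; first exact: (GM _ _ _ _ (GM _ _ _ _ a3G a1G) b2G).
  by rewrite addnC; exact: (GM _ _ _ _ a2G (GM _ _ _ _ b3G b1G)).
- exact: (GM _ _ _ _ (GM _ _ _ _ b3G b1G) b2G).
- by rewrite !is_prime_notinM //; exact: point_prime.
rewrite rmorphD rmorphM /= uE xE yE mulf_div addf_div ?mulf_neq0 //;
  try exact: (point_notin_neq0 (P := P)).
by rewrite !tofracD !tofracM.
Qed.

End ProjStalk.

Section ReesStalk.
Variables (R : idomainType) (I : {pred R}).
Local Notation S := (rees I).

Definition rees_const (c : R) : S := Rees (rees_predC I c).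

Lemma rees_const_zmod : zmod_morphism rees_const.
Proof. by move=> x y; apply: val_inj; rewrite rmorphB /= polyCB. Qed.

Lemma rees_const_monoid : monoid_morphism rees_const.
Proof.
by split=> [|x y]; apply: val_inj; rewrite ?rmorph1 ?rmorphM /= ?polyCM ?polyC1.
Qed.

HB.instance Definition _ := GRing.isZmodMorphism.Build R S rees_const rees_const_zmod.
HB.instance Definition _ := GRing.isMonoidMorphism.Build R S rees_const rees_const_monoid.

(* c t^d, or the junk value 0 when c is not in I^d. *)
Definition rees_mono (d : nat) (c : R) : S := insubd (0 : S) (c *: 'X^d).

Lemma val_rees_mono d c : c \in ideal_pow I d -> val (rees_mono d c) = c *: 'X^d.
Proof.
move=> cI; rewrite val_insubd; case: ifP => // /negP[]; apply/rees_predP => j.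
rewrite coefZ coefXn; have [->|_] := eqVneq j d; first by rewrite mulr1.
by rewrite mulr0 ideal_gen0.
Qed.

Lemma rees_mono_piece d c : c \in ideal_pow I d -> rees_mono d c \in rees_piece d.
Proof. by move=> cI; apply/rees_pieceP; exists c; rewrite -val_rees_mono. Qed.

Lemma rees_monoM d e a b : a \in ideal_pow I d -> b \in ideal_pow I e ->
  rees_mono d a * rees_mono e b = rees_mono (d + e) (a * b).
Proof.
move=> aI bI; apply: val_inj; rewrite rmorphM /=.
rewrite -!/(val _) !val_rees_mono ?ideal_powM //.
by rewrite -scalerAl -scalerAr scalerA exprD.
Qed.

Lemma rees_mono0 c : rees_mono 0 c = rees_const c.
Proof.
apply: val_inj; rewrite val_rees_mono ?ideal_pow0 //= expr0.
by rewrite -mul_polyC mulr1.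
Qed.

Lemma rees_piece_mono d (a : S) : a \in rees_piece d ->
  exists2 c, c \in ideal_pow I d & a = rees_mono d c.
Proof.
move=> /rees_pieceP[c ac]; have cI : c \in ideal_pow I d.
  by have := rees_valP a d; rewrite ac coefZ coefXn eqxx mulr1.
by exists c => //; apply: val_inj; rewrite val_rees_mono.
Qed.

Lemma rees_const_inj : injective rees_const.
Proof. by move=> x y /(congr1 val)/polyC_inj. Qed.

Definition rees_frac : {rmorphism R -> {fraction S}} := @tofrac S \o rees_const.

Lemma rees_frac_inj : injective rees_frac.
Proof. by move=> x y /= /eqP; rewrite tofrac_eq => /eqP/rees_const_inj. Qed.

Lemma rees_frac_eq0 c : (rees_frac c == 0) = (c == 0).
Proof. by rewrite -(rmorph0 rees_frac) (inj_eq rees_frac_inj). Qed.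

Variable P : proj_point (rees_grading I).

Lemma rees_mono_notin_neq0 d b : rees_mono d b \notin point_ideal P -> b != 0.
Proof.
apply: contraNneq => ->; have [P0 _] := point_ideal_closed P.
suff -> : rees_mono d 0 = 0 by [].
by apply: val_inj; rewrite val_rees_mono ?ideal_gen0 // scale0r rmorph0.
Qed.

Lemma stalk_const_subproof c : rees_frac c \in stalk_pred P.
Proof.
apply/stalk_predP; exists 0%N, (rees_const c), 1; split.
- by apply/rees_pieceP; exists c; rewrite expr0 -mul_polyC mulr1.
- exact: rees_piece1.
- by case: (point_prime P) => -[].
- by rewrite tofrac1 divr1.
Qed.

Definition stalk_const c : stalk P := Stalk (stalk_const_subproof c).

Lemma stalk_const_zmod : zmod_morphism stalk_const.
Proof. by move=> x y; apply: val_inj; rewrite rmorphB -[LHS]/(rees_frac (x - y)) rmorphB. Qed.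

Lemma stalk_const_monoid : monoid_morphism stalk_const.
Proof.
split=> [|x y]; apply: val_inj.
  by rewrite rmorph1 -[LHS]/(rees_frac 1) rmorph1.
by rewrite rmorphM -[LHS]/(rees_frac (x * y)) rmorphM.
Qed.

HB.instance Definition _ := GRing.isZmodMorphism.Build R (stalk P) stalk_const stalk_const_zmod.
HB.instance Definition _ := GRing.isMonoidMorphism.Build R (stalk P) stalk_const stalk_const_monoid.

Lemma stalk_mono (z : stalk P) : exists d a b, [/\ a \in ideal_pow I d,
  b \in ideal_pow I d, rees_mono d b \notin point_ideal P
  & val z = tofrac (rees_mono d a) / tofrac (rees_mono d b)].
Proof.
have [d [a' [b' [/rees_piece_mono[a aI ->] /rees_piece_mono[b bI ->] bP zE]]]] := stalk_frac z.
by exists d, a, b.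
Qed.

(** Numerator and denominator have the same degree in t, so the powers of t cancel and the stalk
    lies in the fraction field of [R]. *)
Lemma stalk_const_frac (z : stalk P) :
  exists2 h, h != 0 & exists g, rees_frac h * val z = rees_frac g.
Proof.
have [d [a [b [aI bI bP ->]]]] := stalk_mono z.
exists b; first exact: rees_mono_notin_neq0 bP.
have b0 := point_notin_neq0 bP; exists a.
rewrite mulrA; apply: (mulIf b0); rewrite divfK //= -!tofracM.
by rewrite -!rees_mono0 !rees_monoM ?ideal_pow0 // mulrC.
Qed.

End ReesStalk.

Section ReesTrdeg.
Variables (k : fieldType) (n : nat) (I : {pred {mpoly k[n]}}).
Variable P : proj_point (rees_grading I).

Definition stalk_base : {rmorphism k -> stalk P} := @stalk_const _ _ P \o @mpolyC n k.

Lemma stalk_trdeg m t : indep_mod stalk_base (pred1 0) m t -> (m <= n)%N.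
Proof.
move=> tind; pose iK : {rmorphism k -> {fraction (rees I)}} := rees_frac I \o @mpolyC n k.
have phiC c : rees_frac I c%:MP = iK c by [].
apply: (trdeg_bound (@rees_frac_inj _ I) phiC (t := val \o t)).
  by move=> j _; apply: stalk_const_frac.
move=> q; rewrite -(rmorph_teval (i := stalk_base) (g := val)) //.
rewrite inE => /eqP q0; apply: tind; rewrite inE; apply/eqP/val_inj.
by rewrite rmorph0.
Qed.

End ReesTrdeg.

(** * Complete partite clutters are tame *)

Fixpoint tvar (k : fieldType) (n j : nat) : tower k n :=
  match n return tower k n with
  | 0 => 0
  | m.+1 => if j == m then 'X else (tvar k m j)%:P
  end.

Lemma teval_tvar (k : fieldType) (B : comNzRingType) (i : {rmorphism k -> B}) t n j :
  (j < n)%N -> teval i t n (tvar k n j) = t j.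
Proof.
elim: n => // n IHn; rewrite ltnS leq_eqVlt /= => /orP[/eqP->|jn].
  by rewrite eqxx; exact: tevalX.
by rewrite (ltn_eqF jn) -IHn //; exact: tevalC.
Qed.

Lemma teval_tconst (k : fieldType) (B : comNzRingType) (i : {rmorphism k -> B}) t n c :
  teval i t n (tconst k n c) = i c.
Proof. by elim: n => // n IHn; rewrite -IHn; exact: tevalC. Qed.

Lemma tower_rect (k : fieldType) n (Q : tower k n -> Prop) :
  (forall c, Q (tconst k n c)) -> (forall j, (j < n)%N -> Q (tvar k n j)) ->
  (forall p q, Q p -> Q q -> Q (p + q)) -> (forall p q, Q p -> Q q -> Q (p * q)) ->
  forall q, Q q.
Proof.
elim: n Q => [|n IHn] Q Qc Qv QD QM; first exact: Qc.
have QC c : Q (c%:P : {poly tower k n}).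
  apply: (IHn (fun c => Q (c%:P : {poly tower k n}))) => [a|j jn|p q Qp Qq|p q Qp Qq].
  - exact: Qc.
  - by have := Qv j (ltnW jn); rewrite /= (ltn_eqF jn).
  - by rewrite polyCD; apply: QD.
  - by rewrite polyCM; apply: QM.
elim/poly_ind => [|p c Qp]; first by rewrite -polyC0.
by apply: QD => //; apply: QM => //; have := Qv n (leqnn _); rewrite /= eqxx.
Qed.

Section CircuitMonomials.
Variables (n : nat) (C : {set {set 'I_n}}).

Definition cmon (F : {set 'I_n}) : 'X_{1..n} := [multinom (i \in F : nat) | i < n].

Definition cmon_sum (s : seq {set 'I_n}) : 'X_{1..n} := \big[+%MM/0%MM]_(F <- s) cmon F.

Variable k : fieldType.
Local Notation I := (@circuit_ideal n k C).

Lemma xmonE F : xmon k F = 'X_[cmon F].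
Proof.
rewrite /xmon mpolyXE_id [RHS](bigID (mem F)) /= [X in _ * X]big1 => [|i /negPf iF].
  by rewrite mulr1; apply: eq_bigr => i iF; rewrite mnmE iF expr1.
by rewrite mnmE iF expr0.
Qed.

Definition circuit_prods (d : nat) : {pred {mpoly k[n]}} := fun x =>
  `[< exists s, [/\ size s = d, {subset s <= C} & x = 'X_[cmon_sum s]] >].

Lemma circuit_prodsP d x :
  reflect (exists s, [/\ size s = d, {subset s <= C} & x = 'X_[cmon_sum s]])
          (x \in circuit_prods d).
Proof. exact: asboolP. Qed.

Lemma xmon_circuit_ideal F : F \in C -> xmon k F \in I.
Proof.
by move=> FC; apply: mem_ideal_gen; apply/imageP; exists F.
Qed.

Lemma cmon_sum_pow s : {subset s <= C} -> 'X_[cmon_sum s] \in ideal_pow I (size s).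
Proof.
elim: s => [|F s IHs] sC; first exact: ideal_pow0.
rewrite /cmon_sum big_cons mpolyXD /= -add1n; apply: ideal_powM.
  by rewrite -xmonE; apply/ideal_pow1/xmon_circuit_ideal/sC/mem_head.
by apply: IHs => G Gs; apply: sC; rewrite inE Gs orbT.
Qed.

Lemma circuit_ideal_pow d : {subset ideal_pow I d <= ideal_gen (circuit_prods d)}.
Proof.
apply: ideal_gen_sub; first exact: ideal_gen_closed.
move=> _ /asboolP[f fI ->]; elim: d f fI => [|d IHd] f fI.
  rewrite big_ord0; apply: mem_ideal_gen; apply/circuit_prodsP; exists [::].
  by rewrite /cmon_sum big_nil mpolyX0.
rewrite big_ord_recl; have := IHd (fun j => f (lift ord0 j)) (fun j => fI _).
move: (\prod_(i < d) _) => y yJ; move: (f ord0) (fI ord0) => x xI.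
rewrite mulrC; pose J := ideal_gen (circuit_prods d.+1).
have Jc a : ideal_closed (fun x => a * x \in J).
  exact/ideal_closed_colon/ideal_gen_closed.
apply: (ideal_gen_sub (Jc y)) xI => _ /imageP[F FC ->] /=; rewrite unfold_in mulrC.
apply: (ideal_gen_sub (Jc (xmon k F))) yJ => _ /circuit_prodsP[s [sd sC ->]].
apply: mem_ideal_gen; apply/circuit_prodsP.
exists (F :: s); rewrite /= sd; split=> //.
  by move=> G; rewrite inE => /predU1P[->|/sC].
by rewrite xmonE -mpolyXD /cmon_sum big_cons.
Qed.

End CircuitMonomials.

Section ReesMonoFrac.
Variables (R : idomainType) (I : {pred R}).

Lemma rees_mono_comb d (a x y : R) : x \in ideal_pow I d -> y \in ideal_pow I d ->
  rees_mono I d (a * x + y) = rees_const I a * rees_mono I d x + rees_mono I d y.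
Proof.
move=> xI yI; apply: val_inj; rewrite rmorphD rmorphM /= -!/(val _) !val_rees_mono //.
  by rewrite /= mul_polyC scalerDl scalerA.
by apply: ideal_genD => //; apply: ideal_genMl.
Qed.

Lemma rees_mono_frac d a b : a \in ideal_pow I d -> b \in ideal_pow I d -> b != 0 ->
  tofrac (rees_mono I d a) / tofrac (rees_mono I d b) = rees_frac I a / rees_frac I b.
Proof.
move=> aI bI b0; apply/eqP; rewrite eqr_div /= ?tofrac_eq0.
- by rewrite -!tofracM tofrac_eq -!rees_mono0 !rees_monoM ?ideal_pow0 // addn0 mulrC.
- apply: contraNneq b0 => /(congr1 val); rewrite val_rees_mono // rmorph0.
  move/(congr1 (fun p : {poly R} => p`_d)).
  by rewrite coefZ coefXn eqxx mulr1 coef0 => ->.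
- by apply: contraNneq b0 => /(congr1 val); rewrite rmorph0 /= => /polyC_inj->.
Qed.

End ReesMonoFrac.

Lemma relevant_circuit (k : fieldType) n (C : {set {set 'I_n}})
    (P : proj_point (rees_grading (@circuit_ideal n k C))) :
  exists2 F, F \in C & rees_mono (circuit_ideal C) 1 (xmon k F) \notin point_ideal P.
Proof.
apply: contrapT => H; have {}H F : F \in C ->
    rees_mono (circuit_ideal C) 1 (xmon k F) \in point_ideal P.
  by move=> FC; apply: contrapT => /negP FP; apply: H; exists F.
have [d [x [d0 /rees_piece_mono[c cI ->]]]] := point_relevant P.
move/negP; apply; have Pc := point_ideal_closed P.
set I := circuit_ideal C in cI *.
pose Q : {pred {mpoly k[n]}} := fun c => (c \in ideal_pow I d) &&
  (rees_mono I d c \in point_ideal P).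
suff /andP[] : c \in Q by [].
have Qc : ideal_closed Q.
  split.
    rewrite unfold_in ideal_gen0 /=; suff -> : rees_mono I d 0 = 0 by case: Pc.
    by apply: val_inj; rewrite val_rees_mono ?ideal_gen0 // scale0r rmorph0.
  move=> a u v /andP[uI uP] /andP[vI vP]; apply/andP; split.
    by apply: ideal_genD => //; apply: ideal_genMl.
  by rewrite rees_mono_comb //; case: Pc => _; apply.
apply: (ideal_gen_sub Qc) (circuit_ideal_pow cI).
move=> _ /circuit_prodsP[[|F s] [sd sC ->]]; first by rewrite -sd in d0.
apply/andP; split; first by rewrite -sd; apply: cmon_sum_pow.
have sC' : {subset s <= C} by move=> G Gs; apply: sC; rewrite inE Gs orbT.
rewrite /cmon_sum big_cons mpolyXD -sd /= -add1n -rees_monoM.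
- by rewrite mulrC -xmonE; apply: ideal_closedMl => //; apply/H/sC/mem_head.
- by rewrite -xmonE; apply/ideal_pow1/xmon_circuit_ideal/sC/mem_head.
- exact: (cmon_sum_pow k sC').
Qed.

(** [rho v] is the vertex of [F] in the block of [v]. Blockwise comparison of [F] with another
    circuit [G] then matches [G :\: F] with [F :\: G]. *)
Lemma complete_dpartite_exchange n (C : {set {set 'I_n}}) d F :
  isolated_union_complete_dpartite d C -> F \in C ->
  exists (W : {set 'I_n}) (rho : 'I_n -> 'I_n), [/\ F \subset W,
    forall v, v \in W :\: F -> rho v \in F /\ v |: (F :\ rho v) \in C
  & forall G, G \in C -> [/\ G \subset W, {in G :\: F &, injective rho}
      & rho @: (G :\: F) = F :\: G]].
Proof.
move=> [W [CW [unif [V [[Vdis VW] Cone Vall]]]]] FC.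
have blkP v : v \in W -> exists i, v \in V i.
  by rewrite -VW => /bigcupP[i _ vi]; exists i.
have blk_inj v i j : v \in V i -> v \in V j -> i = j.
  move=> vi vj; apply/eqP; apply: contraLR vj => /Vdis.
  by move/disjointFr => ->.
have one G u v i : G \in C -> u \in G -> v \in G -> u \in V i -> v \in V i -> u = v.
  move=> GC uG vG ui vi; have /card_le1_eqP := Cone G GC i.
  apply; by rewrite inE ?uG ?vG.
(* Pigeonhole: [F] has d vertices in distinct blocks, and there are d blocks. *)
have rep i : exists u, u \in F :&: V i.
  apply/set0Pn; apply/negP => /eqP FV0.
  have [b bP] : {b : 'I_n -> 'I_d & forall v, v \in W -> v \in V (b v)}.
    apply: (@choice _ _ (fun v j => v \in W -> v \in V j)) => v.
    by have [/blkP[j vj]|_] := boolP (v \in W); [exists j | exists i].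
  have binj : {in F &, injective b}.
    move=> u v uF vF buv; apply: (one F u v (b u) FC uF vF).
      by apply/bP/(subsetP (CW F FC)).
    by rewrite buv; apply/bP/(subsetP (CW F FC)).
  have := card_in_imset binj; rewrite (unif F FC) => bd.
  have : b @: F \subset [set~ i].
    apply/subsetP => _ /imsetP[v vF ->]; rewrite !inE; apply/eqP => bvi.
    have : v \in F :&: V i by rewrite inE vF -bvi bP // (subsetP (CW F FC)).
    by rewrite FV0 inE.
  move/subset_leq_card; rewrite bd cardsC1 card_ord.
  by case: (d) i {FV0} => [[]//|e _]; rewrite ltnn.
have [r rP] := choice rep.
pose rho v := if [pick i | v \in V i] is Some i then r i else v.
have rhoE v i : v \in V i -> rho v = r i.
  rewrite /rho => vi; case: pickP => [j vj|/(_ i)]; last by rewrite vi.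
  by rewrite (blk_inj _ _ _ vi vj).
have rF i : r i \in F by have := rP i; rewrite inE => /andP[].
have rV i : r i \in V i by have := rP i; rewrite inE => /andP[].
exists W, rho; split; first exact: CW.
  move=> v /setDP[/blkP[i vi] vF]; rewrite (rhoE v i) //; split=> //.
  have vW : v \in W by rewrite -VW; apply/bigcupP; exists i.
  apply: Vall.
  - apply/subsetP => u; rewrite !inE => /predU1P[->//|/andP[_ uF]].
    exact: (subsetP (CW F FC)).
  - rewrite cardsU1 !inE (negPf vF) andbF add1n -(unif F FC).
    by rewrite [in RHS](cardsD1 (r i)) rF.
  move=> j; apply/card_le1_eqP => x y; rewrite !inE.
  move=> /andP[/predU1P xE xj] /andP[/predU1P yE yj].
  case: xE => [xv|/andP[xr xF]]; case: yE => [yv|/andP[yr yF]].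
  - by rewrite xv yv.
  - have ij : i = j by apply: blk_inj vi _; rewrite -xv.
    by case/eqP: yr; apply: (one F _ _ j) => //; rewrite -ij.
  - have ij : i = j by apply: blk_inj vi _; rewrite -yv.
    by case/eqP: xr; apply: (one F _ _ j) => //; rewrite -ij.
  - exact: (one F _ _ j).
move=> G GC; have GW := subsetP (CW G GC).
have rinj : {in G :\: F &, injective rho}.
  move=> u v /setDP[uG uF] /setDP[vG vF].
  have [i ui] := blkP u (GW u uG); have [j vj] := blkP v (GW v vG).
  rewrite (rhoE u i) // (rhoE v j) // => rij.
  have ij : i = j by apply: (blk_inj (r i)) => //; rewrite rij.
  by apply: (one G _ _ i) => //; rewrite ij.
split=> //; first exact: CW.
apply/eqP; rewrite eqEcard; apply/andP; split.
  apply/subsetP => _ /imsetP[v /setDP[vG vF] ->].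
  have [i vi] := blkP v (GW v vG); rewrite (rhoE v i) // inE rF andbT.
  by apply: contra vF => rG; rewrite (one G v (r i) i).
rewrite card_in_imset // -(leq_add2l #|F :&: G|) cardsID setIC cardsID.
by rewrite (unif F) // (unif G).
Qed.

Section PartiteChart.
Variables (k : fieldType) (n : nat) (C : {set {set 'I_n}}).
Local Notation I := (@circuit_ideal n k C).
Variables (P : proj_point (rees_grading I)) (F W : {set 'I_n}) (rho : 'I_n -> 'I_n).
Hypothesis FC : F \in C.
Hypothesis FP : rees_mono I 1 (xmon k F) \notin point_ideal P.
Hypothesis exchange : forall v, v \in W :\: F -> rho v \in F /\ v |: (F :\ rho v) \in C.
Hypothesis circuits : forall G, G \in C -> [/\ G \subset W,
  {in G :\: F &, injective rho} & rho @: (G :\: F) = F :\: G].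

Let X (v : 'I_n) : {fraction (rees I)} := rees_frac I 'X_v.

Let X_neq0 v : X v != 0.
Proof.
rewrite /X rees_frac_eq0; apply/eqP => /mpolyP/(_ U_(v)%MM)/eqP.
by rewrite mcoeffX eqxx mcoeff0 oner_eq0.
Qed.

Let rf_xmon G : rees_frac I (xmon k G) = \prod_(v in G) X v.
Proof. exact: rmorph_prod. Qed.

Let xmon_neq0 (G : {set 'I_n}) : xmon k G != 0.
Proof. by rewrite -(rees_frac_eq0 I) rf_xmon; apply/prodf_neq0 => v _; exact: X_neq0. Qed.

(** For [v] in [W :\: F] the quotient is [x_G / x_F] with [G] the exchanged circuit
    [v |: (F :\ rho v)]. *)
Let coord_ex v : exists z : stalk P,
  val z = if v \in W :\: F then X v / X (rho v) else X v.
Proof.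
case: ifP => [vWF|_]; last by exists (stalk_const P 'X_v).
have [rF GC] := exchange vWF; have [_ vF] := setDP vWF.
have GI := ideal_pow1 (xmon_circuit_ideal k GC).
have FI := ideal_pow1 (xmon_circuit_ideal k FC).
have [z zE] := stalk_of_frac (P := P) (rees_mono_piece GI) (rees_mono_piece FI) FP.
exists z; rewrite zE rees_mono_frac // !rf_xmon.
rewrite big_setU1 ?(big_setD1 (rho v) rF) /=; last by rewrite !inE (negPf vF) andbF.
apply/eqP; rewrite eqr_div ?X_neq0 //; first by rewrite -mulrA [X in _ == _ * X]mulrC.
by rewrite mulf_neq0 ?X_neq0 //; apply/prodf_neq0 => u _; exact: X_neq0.
Qed.

Let coord v : stalk P := sval (cid (coord_ex v)).

Let val_coord v :
  val (coord v) = if v \in W :\: F then X v / X (rho v) else X v.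
Proof. exact: (svalP (cid (coord_ex v))). Qed.

Let coords (j : nat) : stalk P := if insub j is Some v then coord v else 0.

Let chart : {rmorphism tower k n -> stalk P} := teval (stalk_base P) coords n.

Let T (v : 'I_n) : tower k n := tvar k n v.

Let chart_T v : chart (T v) = coord v.
Proof. by rewrite /chart teval_tvar // /coords valK. Qed.

(* The substitution x_v = y_v y_(rho v), or x_v = y_v off W \ F, which inverts   *)
(* [chart] up to powers of x_F.                                                 *)
Let psi : {rmorphism {mpoly k[n]} -> tower k n} :=
  mmap (tconst k n) (fun v => if v \in W :\: F then T v * T (rho v) else T v).

Let psiX v : psi 'X_v = if v \in W :\: F then T v * T (rho v) else T v.
Proof. by rewrite /psi /= mmapX mmap1U. Qed.

Let notin_WF v : v \in F -> (v \in W :\: F) = false.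
Proof. by move=> vF; rewrite inE vF. Qed.

Let chart_psi p : val (chart (psi p)) = rees_frac I p.
Proof.
have chart_psiX v : val (chart (psi 'X_v)) = X v.
  rewrite psiX; case: ifP => vWF; rewrite ?rmorphM !chart_T ?rmorphM /= val_coord vWF //.
  by rewrite val_coord notin_WF ?divfK ?X_neq0 //; case: (exchange vWF).
elim/mpolyind: p => [|c m p _ _ IHp]; first by rewrite !rmorph0.
rewrite !rmorphD /= IHp; congr (_ + _); rewrite -mul_mpolyC !rmorphM mpolyXE_id.
rewrite !rmorph_prod; congr (_ * _).
  by rewrite /= mmapC /chart teval_tconst.
rewrite [LHS]rmorph_prod; apply: eq_bigr => v _.
transitivity (val (chart (psi 'X_v)) ^+ m v); first by rewrite !rmorphXn.
by rewrite chart_psiX; apply/esym; exact: (rmorphXn (rees_frac I)).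
Qed.

(** [T v * T (rho v)] is the image of ['X_v], and [T (rho v)] divides the image of [x_F], so one
    factor [x_F] brings [T v] into the image of [psi]. Injectivity of [chart] then reduces to that
    of [rees_frac]. *)
Let chart_saturated q : exists N r, q * psi (xmon k F) ^+ N = psi r.
Proof.
elim/tower_rect: q => [c|j jn|p q [N [r pE]] [N' [r' qE]]|p q [N [r pE]] [N' [r' qE]]].
- by exists 0%N, c%:MP; rewrite mulr1 /psi /= mmapC.
- pose v := Ordinal jn; rewrite -[tvar _ _ _]/(T v).
  have [vWF|vWF] := boolP (v \in W :\: F); last first.
    by exists 0%N, 'X_v; rewrite mulr1 psiX (negPf vWF).
  have [rF _] := exchange vWF.
  exists 1%N, ('X_v * \prod_(u in F :\ rho v) 'X_u); rewrite expr1 /xmon.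
  rewrite (big_setD1 (rho v) rF) /= !rmorphM !psiX vWF notin_WF //.
  by rewrite mulrA.
- exists (N + N')%N, (r * xmon k F ^+ N' + r' * xmon k F ^+ N).
  by rewrite rmorphD !rmorphM !rmorphXn -pE -qE exprD; ring.
- by exists (N + N')%N, (r * r'); rewrite rmorphM -pE -qE exprD; ring.
Qed.

Let chart_inj : injective chart.
Proof.
apply: raddf_inj => q q0; have [N [r qr]] := chart_saturated q.
have : rees_frac I r = 0 by rewrite -chart_psi -qr rmorphM q0 mul0r rmorph0.
move/eqP; rewrite rees_frac_eq0 => /eqP r0; move/eqP: qr; rewrite r0 rmorph0.
rewrite mulf_eq0 expf_eq0 => /orP[/eqP//|/andP[_ /eqP xF0]].
have := chart_psi (xmon k F); rewrite xF0 !rmorph0 => /esym/eqP.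
by rewrite rees_frac_eq0 (negPf (xmon_neq0 F)).
Qed.

Let chart_circuit G : G \in C -> 
  exists a, val (chart a) * rees_frac I (xmon k F) = rees_frac I (xmon k G).
Proof.
move=> GC; have [GW rinj rim] := circuits GC; exists (\prod_(v in G :\: F) T v).
rewrite !rf_xmon !rmorph_prod [\prod_(v in F) X v](big_setID G) /=.
rewrite [RHS](big_setID F) /= -rim big_imset //=.
rewrite mulrCA setIC; congr (_ * _); rewrite -big_split /=; apply: eq_bigr => v.
move=> /setDP[vG vF]; rewrite chart_T val_coord inE vF (subsetP GW) //=.
by rewrite divfK ?X_neq0.
Qed.

Let chart_num d c : c \in ideal_pow I d ->
  exists a, val (chart a) * rees_frac I (xmon k F) ^+ d = rees_frac I c.
Proof.
move=> cI; pose Q : {pred {mpoly k[n]}} := fun c =>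
  `[< exists a, val (chart a) * rees_frac I (xmon k F) ^+ d = rees_frac I c >].
suff /asboolP : c \in Q by [].
have Qc : ideal_closed Q.
  split; first by apply/asboolP; exists 0; rewrite !rmorph0 mul0r.
  move=> u x y /asboolP[a ax] /asboolP[b bY]; apply/asboolP.
  exists (psi u * a + b); rewrite !rmorphD !rmorphM mulrDl bY -ax -mulrA.
  by congr (_ * _ + _); exact: chart_psi.
apply: (ideal_gen_sub Qc) (circuit_ideal_pow cI) => _ /circuit_prodsP[s [sd sC ->]].
apply/asboolP; rewrite -{}sd; elim: s sC => [|G s IHs] sC.
  by exists 1; rewrite /cmon_sum big_nil mpolyX0 !rmorph1 mulr1.
have [|a aE] := IHs; first by move=> H Hs; apply: sC; rewrite inE Hs orbT.
have [b bE] := chart_circuit (sC G (mem_head _ _)).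
exists (b * a); rewrite /cmon_sum big_cons mpolyXD -xmonE !rmorphM -bE -aE /= exprS.
by rewrite mulrACA.
Qed.

Lemma partite_chart_regular : regular_local_ring (stalk P).
Proof.
apply: (chart_regular (i := stalk_base P) (phi := chart)) => //.
- by move=> c /=; rewrite /chart teval_tconst.
- exact: stalk_local.
- move=> z; have [e [a [b [aI bI bP zE]]]] := stalk_mono z.
  have [u uE] := chart_num aI; have [v vE] := chart_num bI; exists u, v.
  have b0 := rees_mono_notin_neq0 bP.
  have xF0 : rees_frac I (xmon k F) ^+ e != 0 by rewrite expf_neq0 // rees_frac_eq0.
  have xFI : xmon k F ^+ e \in ideal_pow I e /\
      rees_mono I e (xmon k F ^+ e) \notin point_ideal P.
    have FI := ideal_pow1 (xmon_circuit_ideal k FC).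
    elim: (e) => [|l [lI lP]].
      split; first exact: ideal_pow0.
      by rewrite expr0 rees_mono0 rmorph1; case: (point_prime P) => -[].
    rewrite exprS -add1n; split; first exact: ideal_powM.
    by rewrite -rees_monoM // is_prime_notinM //; exact: point_prime.
  have [xFe xFP] := xFI; split.
    rewrite (stalk_nonunitE (P := P) (rees_mono_piece bI) (rees_mono_piece xFe) xFP) //.
    rewrite rees_mono_frac ?expf_neq0 //.
    by apply: (mulIf xF0); rewrite vE rmorphXn divfK.
  apply: val_inj; rewrite rmorphM; apply: (mulIf xF0); rewrite uE mulrAC vE /=.
  by rewrite zE rees_mono_frac // mulrC divfK ?rees_frac_eq0.
- by move=> m t; exact: stalk_trdeg.
Qed.

End PartiteChart.

Lemma partite_tame (k : fieldType) n (C : {set {set 'I_n}}) d :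
  isolated_union_complete_dpartite d C ->
  proj_regular (rees_grading (@circuit_ideal n k C)).
Proof.
move=> Cd P; have [F FC FP] := relevant_circuit P.
have [W [rho [FW ex circ]]] := complete_dpartite_exchange Cd FC.
exact: (partite_chart_regular FC FP ex circ).
Qed.

(** * The exponent monoid of the chart at a circuit *)

(* [lia] and [nia] compare atoms syntactically, but cardinals and sizes occur  *)
(* with several convertible elaborations of their carrier.                     *)
Definition set_card n (A : {set 'I_n}) : nat := #|A|.
Definition set_size n (s : seq {set 'I_n}) : nat := size s.

Ltac fold_card := repeat match goal with
  | |- context [@card.body ?T (@mem ?X ?Y (@pred_of_set.body ?Z ?A))] =>
      change (@card.body T (@mem X Y (@pred_of_set.body Z A))) with (set_card A)
  | H : context [@card.body ?T (@mem ?X ?Y (@pred_of_set.body ?Z ?A))] |- _ =>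
      change (@card.body T (@mem X Y (@pred_of_set.body Z A))) with (set_card A) in H
  | |- context [@size ?T ?s] => change (@size T s) with (set_size s)
  | H : context [@size ?T ?s] |- _ => change (@size T s) with (set_size s) in H
  end.

Ltac card_lia := fold_card; lia.
Ltac card_nia := fold_card; nia.

Section VertexWeights.
Local Open Scope nat_scope.
Variables (n : nat) (C : {set {set 'I_n}}) (F : {set 'I_n}).
Hypotheses (hC : is_clutter C) (FC : F \in C).
Implicit Types (m : 'X_{1..n}) (G T : {set 'I_n}).

(* For these weights x_F is the unique lightest circuit, with weight #|F|, so    *)
(* every nonzero element of the monoid of the chart at F has positive weight.   *)
Definition wt m : nat := \sum_j (if j \in F then 1 else #|F|.+1) * m j.

Definition outdeg m : nat := \sum_(j | j \notin F) m j.

(* x^m lies in I(C)^d. *)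
Definition mon (d : nat) m : Prop :=
  exists s, [/\ size s = d, {subset s <= C} & (cmon_sum s <= m)%MM].

Lemma wtD m1 m2 : wt (m1 + m2)%MM = (wt m1 + wt m2)%N.
Proof. by rewrite -big_split; apply: eq_bigr => j _; rewrite mnmDE mulnDr. Qed.

Lemma outdegD m1 m2 : outdeg (m1 + m2)%MM = (outdeg m1 + outdeg m2)%N.
Proof. by rewrite -big_split; apply: eq_bigr => j _; rewrite mnmDE. Qed.

Lemma wt0 : wt 0%MM = 0%N.
Proof. by apply: big1 => j _; rewrite mnm0E muln0. Qed.

Lemma outdeg0 : outdeg 0%MM = 0%N.
Proof. by apply: big1 => j _; rewrite mnm0E. Qed.

Lemma wtMn m d : wt (m *+ d)%MM = (d * wt m)%N.
Proof. by elim: d => [|d IHd]; rewrite ?mulm0n ?wt0 // mulmS wtD IHd mulSn. Qed.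

Lemma outdegMn m d : outdeg (m *+ d)%MM = (d * outdeg m)%N.
Proof. by elim: d => [|d IHd]; rewrite ?mulm0n ?outdeg0 // mulmS outdegD IHd mulSn. Qed.

Lemma wt_le m1 m2 : (m1 <= m2)%MM -> (wt m1 <= wt m2)%N.
Proof. by move=> /submK <-; rewrite wtD leq_addl. Qed.

Lemma outdeg_le m1 m2 : (m1 <= m2)%MM -> (outdeg m1 <= outdeg m2)%N.
Proof. by move=> /submK <-; rewrite outdegD leq_addl. Qed.

Lemma wt_eq0 m : wt m = 0%N -> m = 0%MM.
Proof.
move/eqP; rewrite sum_nat_eq0 => /forallP m0; apply/mnmP => j; rewrite mnm0E.
by have := m0 j; rewrite muln_eq0; case: ifP => _ /eqP.
Qed.

Lemma outdeg_cmon G : outdeg (cmon G) = #|G :\: F|.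
Proof.
rewrite -sum1_card /outdeg [LHS]big_mkcond [RHS]big_mkcond.
by apply: eq_bigr => j _; rewrite mnmE inE; case: (j \in F); case: (j \in G).
Qed.

Lemma wt_outdeg m : wt m = (#|F|.+1 * outdeg m + \sum_(j in F) m j)%N.
Proof.
rewrite /wt (bigID (mem F)) /= addnC big_distrr /=; congr (_ + _)%N.
  by apply: eq_bigr => j /negPf->.
by apply: eq_bigr => j ->; rewrite mul1n.
Qed.

Lemma wt_cmon G : wt (cmon G) = (#|F|.+1 * #|G :\: F| + #|G :&: F|)%N.
Proof.
rewrite wt_outdeg outdeg_cmon; congr (_ + _)%N.
rewrite -sum1_card [LHS]big_mkcond [RHS]big_mkcond.
by apply: eq_bigr => j _; rewrite mnmE inE; case: (j \in F); case: (j \in G).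
Qed.

Lemma wt_cmonF : wt (cmon F) = #|F|.
Proof. by rewrite wt_cmon setDv cards0 muln0 setIid. Qed.

Lemma wt_cmon_sub T : T \subset F -> wt (cmon T) = #|T|.
Proof.
move=> TF; rewrite wt_cmon (setIidPl TF).
by move: TF; rewrite -setD_eq0 => /eqP->; rewrite cards0 muln0.
Qed.

Lemma wt1 j : wt U_(j)%MM = if j \in F then 1%N else #|F|.+1.
Proof.
rewrite /wt (bigD1 j) //= mnm1E eqxx muln1 big1 ?addn0 // => l lj.
by rewrite mnm1E eq_sym (negPf lj) muln0.
Qed.

Lemma circuit_outdeg G : G \in C -> G != F -> (0 < #|G :\: F|)%N.
Proof.
move=> GC; apply: contraNT; rewrite -leqNgt leqn0 cards_eq0 setD_eq0 => GF.
by rewrite (hC GC FC GF).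
Qed.

Lemma circuit_wt G : G \in C -> G != F -> (#|F| < wt (cmon G))%N.
Proof. by move=> GC /(circuit_outdeg GC); rewrite wt_cmon; card_nia. Qed.

Lemma wt_cmon_sum s : {subset s <= C} ->
  (size s * #|F| <= wt (cmon_sum s))%N /\
  (wt (cmon_sum s) = size s * #|F| -> cmon_sum s = cmon F *+ size s)%MM.
Proof.
elim: s => [|G s IHs] sC; rewrite /cmon_sum ?big_nil ?big_cons.
  by rewrite wt0 mul0n mulm0n.
have [|sF seq] := IHs; first by move=> H Hs; apply: sC; rewrite inE Hs orbT.
rewrite -/(cmon_sum s) wtD /= mulSn mulmS.
have [->|GF] := eqVneq G F.
  by rewrite wt_cmonF; split=> [|sz]; [card_lia | rewrite seq //; card_lia].
have := circuit_wt (sC G (mem_head _ _)) GF; split; card_lia.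
Qed.

Lemma wt_mon d m : mon d m -> (d * #|F| <= wt m)%N.
Proof.
move=> [s [<- sC sm]]; apply: leq_trans (wt_le sm).
by case: (wt_cmon_sum sC).
Qed.

Lemma wt_mon_eq d m : mon d m -> (wt m <= d * #|F|)%N -> m = (cmon F *+ d)%MM.
Proof.
move=> [s [<- sC sm]]; have [sF seq] := wt_cmon_sum sC.
rewrite -(submK sm) wtD => mF; have r0 : wt (m - cmon_sum s)%MM = 0%N by card_lia.
by rewrite (wt_eq0 r0) add0m seq //; card_lia.
Qed.

(** On exponents of the d-th power of the ideal the weight is at least [d * #|F|], with equality
    only at [x_F^d]. This is the vertex property of [F]: its monoid has no nontrivial unit. *)
Lemma mon_vertex d1 d2 m1 m2 : mon d1 m1 -> mon d2 m2 ->
  (m1 + m2 = cmon F *+ (d1 + d2))%MM ->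
  m1 = (cmon F *+ d1)%MM /\ m2 = (cmon F *+ d2)%MM.
Proof.
move=> M1 M2 /(congr1 wt); rewrite wtD wtMn wt_cmonF => E.
have := wt_mon M1; have := wt_mon M2.
by split; apply: wt_mon_eq => //; card_lia.
Qed.

(* x^H / x_F is an irreducible element of the monoid of the chart at F. *)
Definition irr (H : 'X_{1..n}) : Prop := H <> cmon F /\
  forall d1 d2 m1 m2, mon d1 m1 -> mon d2 m2 ->
  (m1 + m2 + cmon F = H + cmon F *+ (d1 + d2))%MM ->
  m1 = (cmon F *+ d1)%MM \/ m2 = (cmon F *+ d2)%MM.

(** For [v] outside [F], the sets [T] for which e_v - e_T is a given generator of the monoid: e_v
    itself, or e_G - e_F for the circuit [G] replacing [T] by [v]. *)
Definition admissible (v : 'I_n) : pred {set 'I_n} := fun T =>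
  (T \subset F) && ((T == set0) || (v |: (F :\: T) \in C)).

Lemma admissible0 v : admissible v set0.
Proof. by rewrite /admissible sub0set eqxx. Qed.

(* The outer generator attached to v is e_v - e_(tmax v). *)
Definition tmax (v : 'I_n) : {set 'I_n} := [arg max_(T > set0 | admissible v T) #|T|].

Lemma tmax_admissible v : admissible v (tmax v).
Proof. by rewrite /tmax; case: arg_maxnP => //; exact: admissible0. Qed.

Lemma tmax_max v T : admissible v T -> (#|T| <= #|tmax v|)%N.
Proof. by rewrite /tmax; case: arg_maxnP => [|U _ Umax /Umax//]; exact: admissible0. Qed.

(** An element of the monoid whose only vertex outside [F] is [v] weighs at least as much as some
    e_v - e_T. Either all its circuits are [F], and [v] is left over with its full weight, or one
    circuit [G] has [G :\: F] equal to the singleton of [v], and [T] is [F :\: G]. *)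
Lemma mon_outdeg1 d m v : v \notin F -> mon d m -> (0 < m v)%N -> (outdeg m <= 1)%N ->
  exists2 T, admissible v T & (d * #|F| + #|F|.+1 <= wt m + #|T|)%N.
Proof.
move=> vF [s [sd sC sm]] mv om.
have [sF|] := boolP (all (pred1 F) s).
  exists set0; first exact: admissible0.
  rewrite cards0 addn0 -(submK sm) wtD addnC leq_add //; last first.
    by rewrite -sd; case: (wt_cmon_sum sC).
  have -> : #|F|.+1 = wt U_(v)%MM by rewrite wt1 (negPf vF).
  apply: wt_le; rewrite lep1mP mnmBE /cmon_sum mnm_sumE big_seq big1 ?subn0 -?lt0n //.
  by move=> G /(allP sF)/eqP->; rewrite mnmE (negPf vF).
move=> /allPn[G Gs GF]; have GC := sC G Gs.
have sE : cmon_sum s = (cmon G + cmon_sum (rem G s))%MM.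
  by rewrite /cmon_sum (big_rem G) //=.
have Gm : (cmon G <= m)%MM.
  by apply: lepm_trans sm; rewrite sE lem_addr.
have oG := circuit_outdeg GC GF.
have oG1 : #|G :\: F| = 1%N.
  by have := outdeg_le Gm; rewrite outdeg_cmon; card_lia.
have /cards1P[x xE] : #|G :\: F| == 1%N by rewrite oG1.
have xG : x \in G :\: F by rewrite xE set11.
have xv : x = v.
  apply/eqP; apply: contraTT om => xv; rewrite -ltnNge /outdeg.
  have xF : x \notin F by case/setDP: xG.
  rewrite (bigD1 x) //= (bigD1 v) /=; last by rewrite vF eq_sym.
  have : (0 < m x)%N.
    by have /mnm_lepP/(_ x) := Gm; rewrite mnmE; case/setDP: xG => ->.
  by card_lia.
have FGI : F :\: (F :\: G) = G :&: F by rewrite setDDr setDv set0U setIC.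
exists (F :\: G).
  rewrite /admissible subsetDl FGI -xv -xE setUC setID GC orbT //.
have sz : size s = (size (rem G s)).+1 by rewrite size_rem // prednK //; case: (s) Gs.
have [|rF _] := @wt_cmon_sum (rem G s); first by move=> K /mem_rem/sC.
have := wt_le sm; rewrite sE wtD wt_cmon oG1.
have := cardsID G F; rewrite setIC -sd sz mulSn; card_lia.
Qed.

Lemma outdegF : outdeg (cmon F) = 0%N.
Proof. by rewrite outdeg_cmon setDv cards0. Qed.

Lemma irr_inner u : u \in F -> irr (cmon F + U_(u))%MM.
Proof.
move=> uF; split.
  by move/mnmP/(_ u); rewrite mnmDE mnmE mnm1E uF eqxx.
move=> d1 d2 m1 m2 M1 M2 /(congr1 wt); rewrite !wtD wtMn wt1 uF wt_cmonF => E.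
have := wt_mon M1; have := wt_mon M2 => h1 h2.
have [le1|lt1] := leqP (wt m1) (d1 * #|F|); [left|right]; apply: wt_mon_eq => //; card_lia.
Qed.

Definition outer (v : 'I_n) : 'X_{1..n} := (cmon F + U_(v) - cmon (tmax v))%MM.

Lemma outerK v : (outer v + cmon (tmax v) = cmon F + U_(v))%MM.
Proof.
rewrite submK //; apply/mnm_lepP => j; rewrite mnmDE !mnmE.
have /andP[/subsetP/(_ j) TF _] := tmax_admissible v.
by case: (j \in tmax v) TF => // ->.
Qed.

(** By maximality of [tmax v], this element has the least weight among those involving [v] once and
    no other vertex outside [F]. In a decomposition the factor containing [v] takes all the weight,
    so the other is trivial. *)
Lemma irr_outer v : v \notin F -> irr (outer v).
Proof.
move=> vF; have /andP[TF _] := tmax_admissible v; split.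
  move=> H; have := congr1 outdeg (outerK v); rewrite H !outdegD outdegF.
  have := wt_cmon_sub TF; rewrite wt_outdeg.
  have := wt_outdeg U_(v)%MM; rewrite wt1 (negPf vF).
  have -> : \sum_(j in F) U_(v)%MM j = 0%N.
    by apply: big1 => j jF; rewrite mnm1E; case: eqP => // vj; rewrite vj jF in vF.
  by have := subset_leq_card TF; card_nia.
move=> d1 d2 m1 m2 M1 M2 E.
have {}E : (m1 + m2 + cmon (tmax v) = U_(v) + cmon F *+ (d1 + d2))%MM.
  apply: (@addmI _ (cmon F)); rewrite addmC -!addmA.
  rewrite [(cmon (tmax v) + cmon F)%MM]addmC !addmA E.
  by rewrite addmC addmA [(_ + outer v)%MM]addmC outerK.
have oE : (outdeg m1 + outdeg m2 = 1)%N.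
  have := congr1 outdeg E; rewrite !outdegD outdegMn outdegF muln0 addn0.
  have -> : outdeg (cmon (tmax v)) = 0%N.
    by rewrite outdeg_cmon; move: TF; rewrite -setD_eq0 => /eqP->; rewrite cards0.
  rewrite addn0 => ->; rewrite /outdeg (bigD1 v) //= mnm1E eqxx big1 // => j /andP[_ jv].
  by rewrite mnm1E eq_sym (negPf jv).
have wE := congr1 wt E; rewrite !wtD wtMn wt1 (negPf vF) wt_cmonF wt_cmon_sub // in wE.
have vE : (m1 v + m2 v = 1)%N.
  have := congr1 (fun m : 'X_{1..n} => m v) E; rewrite !mnmDE mulmnE !mnmE eqxx (negPf vF).
  have -> : v \in tmax v = false by apply: contraNF vF; exact: (subsetP TF).
  by rewrite mul0n !addn0.
have [m1v|m1v] := posnP (m1 v); [left | right]; apply: wt_mon_eq => //.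
  have [||T /tmax_max Tm Td] := mon_outdeg1 vF M2; card_lia.
have [||T /tmax_max Tm Td] := mon_outdeg1 vF M1; card_lia.
Qed.

Section ExtraGenerator.
Variable u : 'I_n.
Hypothesis uF : u \in F.

(* Linear form with value 1 on x_F and at least 1 on x_F times any inner or outer *)
(* generator; a circuit where it vanishes is not generated by these.            *)
Definition covdeg m : nat := (m u + \sum_(v | (v \notin F) && (u \in tmax v)) m v)%N.

Lemma covdegD m1 m2 : covdeg (m1 + m2)%MM = (covdeg m1 + covdeg m2)%N.
Proof.
rewrite /covdeg mnmDE (eq_bigr (fun v => m1 v + m2 v)%N) => [|v _]; last by rewrite mnmDE.
by rewrite big_split addnACA.
Qed.

Lemma covdeg0 : covdeg 0%MM = 0%N.
Proof. by rewrite /covdeg mnm0E big1 // => v _; rewrite mnm0E. Qed.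

Lemma covdegMn m d : covdeg (m *+ d)%MM = (d * covdeg m)%N.
Proof. by elim: d => [|d IHd]; rewrite ?mulm0n ?covdeg0 // mulmS covdegD IHd mulSn. Qed.

Lemma covdegF : covdeg (cmon F) = 1%N.
Proof.
rewrite /covdeg mnmE uF big1 // => v /andP[vF _]; by rewrite mnmE (negPf vF).
Qed.

Lemma covdeg_outer v : v \notin F -> covdeg (outer v) = 1%N.
Proof.
move=> vF; have := congr1 covdeg (outerK v); rewrite !covdegD covdegF.
have /andP[/subsetP TF _] := tmax_admissible v.
suff -> : covdeg (cmon (tmax v)) = covdeg U_(v)%MM by card_lia.
rewrite /covdeg mnmE big1 ?addn0 => [|w /andP[wF _]]; last first.
  by rewrite mnmE; case: (boolP (w \in tmax v)) => // /TF; rewrite (negPf wF).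
rewrite mnm1E; have -> : (v == u) = false by apply: contraNF vF => /eqP->.
rewrite add0n; have [uv|uv] := boolP (u \in tmax v).
  rewrite (bigD1 v) ?vF //= mnm1E eqxx big1 // => w /andP[_ wv].
  by rewrite mnm1E eq_sym (negPf wv).
rewrite big1 // => w /andP[_ uw]; rewrite mnm1E; case: eqP => // vw.
by rewrite vw uw in uv.
Qed.

(** Take the lightest circuit where [covdeg] vanishes. In a decomposition some factor has [covdeg]
    below its degree, hence contains a circuit with [covdeg] 0; minimality gives that factor all the
    weight, so the other is trivial. *)
Lemma irr_extra G0 : G0 \in C -> covdeg (cmon G0) = 0%N ->
  exists2 G, G \in C & covdeg (cmon G) = 0%N /\ irr (cmon G).
Proof.
move=> G0C /eqP G00; pose bad G := (G \in C) && (covdeg (cmon G) == 0%N).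
have badG0 : bad G0 by rewrite /bad G0C.
case: (arg_minnP (fun G => wt (cmon G)) badG0) => G /andP[GC /eqP G0'] Gmin.
exists G => //; split=> //; split.
  by move=> GF; have := covdegF; rewrite -GF G0'.
have aux d m : mon d m -> (covdeg m < d)%N -> (wt (cmon G) + d.-1 * #|F| <= wt m)%N.
  move=> [s [sd sC sm]] md.
  have [K Ks K0] : exists2 K, K \in s & covdeg (cmon K) = 0%N.
    apply: contrapT => H; suff : (d <= covdeg m)%N by rewrite leqNgt md.
    rewrite -(submK sm) covdegD (leq_trans _ (leq_addl _ _)) // -sd.
    have {}H K : K \in s -> (0 < covdeg (cmon K))%N.
      by move=> Ks; rewrite lt0n; apply/eqP => K0; apply: H; exists K.
    elim: (s) H => [|K r IHr] H; first by rewrite leq0n.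
    rewrite /cmon_sum big_cons covdegD -/(cmon_sum r) /= -add1n leq_add ?H ?mem_head //.
    by apply: IHr => L Lr; apply: H; rewrite inE Lr orbT.
  have := Gmin K; rewrite /bad sC // K0 => /(_ isT) GK.
  apply: leq_trans (wt_le sm); rewrite /cmon_sum (big_rem K) //= wtD leq_add //.
  have [|rF _] := @wt_cmon_sum (rem K s); first by move=> L /mem_rem/sC.
  by rewrite -sd -(size_rem Ks).
move=> d1 d2 m1 m2 M1 M2 E.
have := congr1 wt E; rewrite !wtD wtMn wt_cmonF => wE.
have := congr1 covdeg E; rewrite !covdegD covdegMn covdegF G0' => cE.
have [lt1|le1] := ltnP (covdeg m1) d1.
  have A1 := aux _ _ M1 lt1; right; apply: wt_mon_eq => //.
  by case: (d1) lt1 A1 wE => // e _ /=; rewrite addSn !mulSn mulnDl; card_lia.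
have lt2 : (covdeg m2 < d2)%N by card_lia.
have A2 := aux _ _ M2 lt2; left; apply: wt_mon_eq => //.
by case: (d2) lt2 A2 wE => // e _ /=; rewrite addnS !mulSn mulnDl; card_lia.
Qed.

End ExtraGenerator.

End VertexWeights.

(** * The torus-fixed point of a circuit and its tangent space *)

Lemma mcoeffM_eq0 (R : comNzRingType) n (a b : {mpoly R[n]}) m :
  (forall m1 m2, m1 \in msupp a -> m2 \in msupp b -> (m1 + m2)%MM <> m) ->
  (a * b)@_m = 0.
Proof.
move=> ab; rewrite mcoeffM big1 // => l /eqP ml.
have [/memN_msupp_eq0->|la] := boolP (bmnm l.1 \notin msupp a); first by rewrite mul0r.
have [/memN_msupp_eq0->|lb] := boolP (bmnm l.2 \notin msupp b); first by rewrite mulr0.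
by case: (ab _ _ (negbNE la) (negbNE lb)).
Qed.

Section VertexCoefficients.
Variables (k : fieldType) (n : nat) (C : {set {set 'I_n}}) (F : {set 'I_n}).
Hypotheses (hC : is_clutter C) (FC : F \in C).
Local Notation I := (@circuit_ideal n k C).
Implicit Types (a b c : {mpoly k[n]}).

Lemma msupp_ideal_pow d c m : c \in ideal_pow I d -> m \in msupp c -> mon C d m.
Proof.
pose Q : {pred {mpoly k[n]}} := fun c =>
  `[< forall m, m \in msupp c -> mon C d m >].
move=> cI; suff /asboolP : c \in Q by apply.
apply: ideal_gen_sub (circuit_ideal_pow cI).
  split; first by apply/asboolP => l; rewrite msupp0.
  move=> a x y /asboolP xQ /asboolP yQ; apply/asboolP => l.
  move/msuppD_le; rewrite mem_cat => /orP[/msuppM_le/allpairsP[[m1 m2] /= [_ m2x ->]]|/yQ//].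
  have [s [sd sC sm]] := xQ _ m2x; exists s; split=> //.
  exact: lepm_trans sm (lem_addl _ _).
move=> _ /circuit_prodsP[s [sd sC ->]]; apply/asboolP => l /mem_msuppXP <-.
by exists s; rewrite lepm_refl.
Qed.

Definition vertex_coef d c : k := c@_(cmon F *+ d).

Definition split_vertex d c := c - vertex_coef d c *: 'X_[cmon F *+ d].

Lemma split_vertexE d c : c = vertex_coef d c *: 'X_[cmon F *+ d] + split_vertex d c.
Proof. by rewrite /split_vertex addrC subrK. Qed.

Lemma msupp_split_vertex d c m : m \in msupp (split_vertex d c) ->
  m \in msupp c /\ m <> (cmon F *+ d)%MM.
Proof.
rewrite !mcoeff_msupp mcoeffB mcoeffZ mcoeffX => mc.
have mF : m <> (cmon F *+ d)%MM.
  by move=> mF; rewrite mF eqxx mulr1 subrr eqxx in mc.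
split=> //; move: mc; have [Fm|_] := eqVneq (cmon F *+ d)%MM m; first by case: mF.
by rewrite mulr0 subr0.
Qed.

(** [vertex_coef d c] is the value of [c / x_F^d] at the torus-fixed point. It is multiplicative
    because, by [mon_vertex], only the two vertex terms contribute to the coefficient. *)
Lemma vertex_coefM d e a b : a \in ideal_pow I d -> b \in ideal_pow I e ->
  vertex_coef (d + e) (a * b) = vertex_coef d a * vertex_coef e b.
Proof.
move=> aI bI; rewrite {1}(split_vertexE d a) mulrDl /vertex_coef mcoeffD.
have FD : (cmon F *+ (d + e) = cmon F *+ d + cmon F *+ e)%MM.
  by apply/mnmP => j; rewrite mnmDE !mulmnE mulnDr.
rewrite [X in _ + X]mcoeffM_eq0 ?addr0 => [|m1 m2].
  by rewrite -scalerAl mcoeffZ FD ['X_[_] * b]mulrC mcoeffMX.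
move=> /msupp_split_vertex[m1a m1F] m2b E.
by case: (mon_vertex hC FC (msupp_ideal_pow aI m1a) (msupp_ideal_pow bI m2b) E).
Qed.

Section Tangent.
Variable H : 'X_{1..n}.
Hypothesis irrH : irr C F H.

(* The coefficient of c / x_F^d at x^H / x_F; multiplying by x_F first keeps the  *)
(* exponents nonnegative.                                                       *)
Definition tangent_coef d c : k := (c * 'X_[cmon F])@_(H + cmon F *+ d).

Lemma tangent_coefD d a b :
  tangent_coef d (a + b) = tangent_coef d a + tangent_coef d b.
Proof. by rewrite /tangent_coef mulrDl mcoeffD. Qed.

Lemma tangent_coef_sum d (T : finType) (f : T -> {mpoly k[n]}) :
  tangent_coef d (\sum_j f j) = \sum_j tangent_coef d (f j).
Proof. by rewrite /tangent_coef mulr_suml raddf_sum. Qed.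

Lemma tangent_coefZ d (x : k) a : tangent_coef d (x *: a) = x * tangent_coef d a.
Proof. by rewrite /tangent_coef -scalerAl mcoeffZ. Qed.

Lemma tangent_coefMX d e a :
  tangent_coef (d + e) ('X_[cmon F *+ d] * a) = tangent_coef e a.
Proof.
rewrite /tangent_coef.
have -> : (H + cmon F *+ (d + e) = cmon F *+ d + (H + cmon F *+ e))%MM.
  by apply/mnmP => j; rewrite !mnmDE !mulmnE mulnDr addnCA.
by rewrite -mulrA ['X_[_] * (a * _)]mulrC mcoeffMX.
Qed.

Lemma tangent_coefX d : tangent_coef d 'X_[cmon F *+ d] = 0.
Proof.
rewrite /tangent_coef -mpolyXD mcoeffX addmC eqm_add2r; case: eqP => // E.
by case: irrH => /(_ (esym E)).
Qed.

(** The Leibniz rule at the fixed point: a product of two non-vertex terms cannot contribute, since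
    [H] is irreducible. *)
Lemma tangent_coefM d e a b : a \in ideal_pow I d -> b \in ideal_pow I e ->
  tangent_coef (d + e) (a * b) =
    vertex_coef d a * tangent_coef e b + tangent_coef d a * vertex_coef e b.
Proof.
move=> aI bI; rewrite {1}(split_vertexE d a) mulrDl tangent_coefD.
rewrite -scalerAl tangent_coefZ tangent_coefMX; congr (_ + _).
rewrite {1}(split_vertexE e b) mulrDr tangent_coefD -scalerAr tangent_coefZ.
rewrite [split_vertex d a * 'X_[_]]mulrC {1}[(d + e)%N]addnC tangent_coefMX.
rewrite [X in _ + X](_ : _ = 0) ?addr0; last first.
  rewrite /tangent_coef mcoeffM_eq0 // => m m' mab.
  rewrite msuppX inE => /eqP-> E.
  have /allpairsP[[m1 m2] /= [m1a m2b mE]] := msuppM_le mab.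
  have [m1s m1F] := msupp_split_vertex m1a; have [m2s m2F] := msupp_split_vertex m2b.
  have := irrH.2 _ _ _ _ (msupp_ideal_pow aI m1s) (msupp_ideal_pow bI m2s).
  by rewrite -mE E addnC => /(_ erefl)[].
rewrite mulrC; congr (_ * _); rewrite [in RHS](split_vertexE d a) [RHS]tangent_coefD tangent_coefZ.
by rewrite tangent_coefX mulr0 add0r.
Qed.

End Tangent.

(** The graded homomorphism from the Rees algebra to k[t] that keeps only the monomials [x_F^d t^d];
    its kernel is the point sought. *)
Definition vertex_poly (p : rees I) : {poly k} :=
  \poly_(d < size (val p)) vertex_coef d (val p)`_d.

Lemma coef_vertex_poly p d : (vertex_poly p)`_d = vertex_coef d (val p)`_d.
Proof.
rewrite coef_poly; case: ltnP => // dp.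
by rewrite nth_default // /vertex_coef mcoeff0.
Qed.

Lemma vertex_poly_zmod : zmod_morphism vertex_poly.
Proof.
move=> p q; apply/polyP => d; rewrite coefB !coef_vertex_poly rmorphB coefB.
by rewrite /vertex_coef mcoeffB.
Qed.

Lemma vertex_poly_monoid : monoid_morphism vertex_poly.
Proof.
split=> [|p q]; apply/polyP => d.
  rewrite coef_vertex_poly rmorph1 !coef1 /vertex_coef; case: d => [|d] /=.
    by rewrite mcoeff1 mulm0n eqxx.
  by rewrite mcoeff0.
rewrite coefM coef_vertex_poly rmorphM coefM /vertex_coef raddf_sum /=.
apply: eq_bigr => j _; rewrite !coef_vertex_poly -vertex_coefM ?rees_valP //.
by rewrite subnKC // -ltnS.
Qed.

HB.instance Definition _ :=
  GRing.isZmodMorphism.Build (rees I) {poly k} vertex_poly vertex_poly_zmod.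
HB.instance Definition _ :=
  GRing.isMonoidMorphism.Build (rees I) {poly k} vertex_poly vertex_poly_monoid.

Definition vertex_ideal : {pred rees I} := fun p => vertex_poly p == 0.

Lemma vertex_ideal_prime : is_prime vertex_ideal.
Proof.
split; first split; rewrite ?unfold_in ?rmorph0 ?rmorph1 ?oner_eq0 //.
  move=> a p q; rewrite !unfold_in rmorphD rmorphM /= => /eqP-> /eqP->.
  by rewrite mulr0 addr0.
by move=> p q; rewrite !unfold_in rmorphM mulf_eq0.
Qed.

Lemma vertex_ideal_mono d c : c \in ideal_pow I d ->
  (rees_mono I d c \in vertex_ideal) = (vertex_coef d c == 0).
Proof.
move=> cI; rewrite unfold_in; apply/eqP/eqP => [/polyP/(_ d)|c0].
  by rewrite coef_vertex_poly val_rees_mono // coefZ coefXn eqxx mulr1 coef0.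
apply/polyP => e; rewrite coef_vertex_poly val_rees_mono // coefZ coefXn coef0.
by have [->|_] := eqVneq e d; rewrite ?mulr1 // mulr0 /vertex_coef mcoeff0.
Qed.

Lemma vertex_ideal_homogeneous : homogeneous_ideal (rees_grading I) vertex_ideal.
Proof.
move=> p p0; exists (size (val p)), (fun i => rees_mono I i (val p)`_i).
  move=> i; split; last by apply: rees_mono_piece; exact: rees_valP.
  rewrite vertex_ideal_mono ?rees_valP //.
  move: p0; rewrite unfold_in => /eqP/polyP/(_ i).
  by rewrite coef_vertex_poly coef0 => ->.
apply: val_inj; rewrite rmorph_sum -[LHS]coefK poly_def; apply: eq_bigr => i _.
by apply/esym; exact: (val_rees_mono (rees_valP p i)).
Qed.

Lemma vertex_coefF : vertex_coef 1 (xmon k F) = 1.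
Proof. by rewrite /vertex_coef xmonE mcoeffX mulm1n eqxx. Qed.

Lemma vertex_ideal_relevant :
  exists d x, [/\ (0 < d)%N, x \in rees_grading I d & x \notin vertex_ideal].
Proof.
have FI := ideal_pow1 (xmon_circuit_ideal k FC).
exists 1%N, (rees_mono I 1 (xmon k F)); split=> //; first exact: rees_mono_piece.
by rewrite vertex_ideal_mono // vertex_coefF oner_eq0.
Qed.

Definition vertex_point : proj_point (rees_grading I) :=
  ProjPoint vertex_ideal_prime vertex_ideal_homogeneous vertex_ideal_relevant.

End VertexCoefficients.

Lemma stalk_common_denominator (R : idomainType) (I : {pred R})
    (P : proj_point (rees_grading I)) (s : seq (stalk P)) :
  exists D b, [/\ b \in ideal_pow I D, rees_mono I D b \notin point_ideal P
    & forall z, z \in s -> exists2 a, a \in ideal_pow I D &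
        val z * rees_frac I b = rees_frac I a].
Proof.
elim: s => [|z s [D [b [bI bP sb]]]].
  exists 0%N, 1; split=> //; first exact: ideal_pow0.
  by rewrite rees_mono0 rmorph1; case: (point_prime P) => -[].
have [e [a [c [aI cI cP zE]]]] := stalk_mono z.
have c0 := rees_mono_notin_neq0 cP.
have rc0 : rees_frac I c != 0 by rewrite rees_frac_eq0.
exists (D + e)%N, (b * c); split; first exact: ideal_powM.
  by rewrite -rees_monoM // is_prime_notinM //; exact: point_prime.
move=> y; rewrite inE => /predU1P[->|/sb[a' a'I ya']].
  exists (b * a); first exact: ideal_powM.
  by rewrite zE rees_mono_frac // !rmorphM mulrCA divfK.
by exists (a' * c); [exact: ideal_powM | rewrite !rmorphM mulrA ya'].
Qed.

Section IrreducibleBound.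
Variables (k : fieldType) (n : nat) (C : {set {set 'I_n}}) (F : {set 'I_n}).
Hypotheses (hC : is_clutter C) (FC : F \in C).
Local Notation I := (@circuit_ideal n k C).
Local Notation P := (@vertex_point k n C F hC FC).

Lemma mon1_ideal H : mon C 1 H -> 'X_[H] \in ideal_pow I 1.
Proof.
move=> [s [s1 sC sH]]; rewrite -(submK sH) mpolyXD; apply: ideal_genMl.
by have := cmon_sum_pow k sC; rewrite s1.
Qed.

(** The empty family is independent modulo the top prime, since nonzero constants are units; the
    chain lengthens it to [d] independent elements of the stalk. *)
Lemma stalk_chain_bound d : has_prime_chain (stalk P) d -> (d <= n)%N.
Proof.
move=> [c cP cS].
have [|t tP] := chain_indep (i := stalk_base P) (m := 0) (t := fun=> 0) cP cS.
  move=> q qc; apply/eqP; apply: contraTT qc => q0.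
  have [[_ c1 _] _] := cP d (leqnn d); apply: contra c1 => /= qc.
  rewrite -(rmorph1 (stalk_base P)) -(mulVf q0) rmorphM.
  by apply: ideal_closedMl => //; case: (cP d (leqnn d)) => /idealr_closedW.
apply: (stalk_trdeg (P := P) (t := t)); apply: indep_mod_sub tP => x.
by rewrite inE => /eqP->; case: (cP 0%N isT) => -[].
Qed.

(** The elements [x^(H a) / x_F] lie in the maximal ideal and are dual to the derivations
    [tangent_coef F (H a)]. A point derivation on that ideal is determined by its values on d
    generators, so r <= d, where d is the dimension. *)
Lemma irr_bound r (H : 'I_r -> 'X_{1..n}) : injective H ->
  (forall a, irr C F (H a)) -> (forall a, mon C 1 (H a)) ->
  regular_local_ring (stalk P) -> (r <= n)%N.
Proof.
move=> Hinj Hirr Hmon [_ [m [mmax _ [d [[chain _] [s mE]]]]]].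
apply: leq_trans (stalk_chain_bound chain).
have {}mE : nonunits (stalk P) =i ideal_gen (mem s).
  by move=> x; rewrite -mE; apply/esym/(nonunits_unique (stalk_local P)).
have FI := ideal_pow1 (xmon_circuit_ideal k FC).
have FP : rees_mono I 1 (xmon k F) \notin point_ideal P.
  by rewrite vertex_ideal_mono // vertex_coefF oner_eq0.
have HI a := mon1_ideal (Hmon a).
have [c cE] : {c : 'I_r -> 'I_d -> stalk P & forall a,
    val (\sum_j c a j * tnth s j) * rees_frac I (xmon k F) = rees_frac I 'X_[H a]}.
  apply: (@choice _ _ (fun a c =>
    val (\sum_j c j * tnth s j) * rees_frac I (xmon k F) = rees_frac I 'X_[H a])) => a.
  have [z zE] := stalk_of_frac (P := P) (rees_mono_piece (HI a)) (rees_mono_piece FI) FP.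
  have zN : z \in nonunits (stalk P).
    rewrite (stalk_nonunitE (P := P) (rees_mono_piece (HI a)) (rees_mono_piece FI) FP zE).
    rewrite vertex_ideal_mono // /vertex_coef mcoeffX mulm1n.
    by have [/eqP/negPf-> _] := Hirr a.
  move: zN; rewrite mE => /ideal_gen_tuple[c cE]; exists c.
  have F0 : xmon k F != 0 by exact: rees_mono_notin_neq0 FP.
  by rewrite -cE zE rees_mono_frac ?divfK ?rees_frac_eq0.
pose L := s ++ [seq c a j | a <- enum 'I_r, j <- enum 'I_d].
have [D [b [bI bP Lb]]] := stalk_common_denominator L.
have [g gP] : {g : 'I_d -> {mpoly k[n]} & forall j, g j \in ideal_pow I D /\
    val (tnth s j) * rees_frac I b = rees_frac I (g j)}.
  apply: (@choice _ _ (fun j g => g \in ideal_pow I D /\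
    val (tnth s j) * rees_frac I b = rees_frac I g)) => j.
  have [|g gI gE] := Lb (tnth s j); first by rewrite mem_cat mem_tnth.
  by exists g.
have [h hP] : {h : 'I_r * 'I_d -> {mpoly k[n]} & forall aj, h aj \in ideal_pow I D /\
    val (c aj.1 aj.2) * rees_frac I b = rees_frac I (h aj)}.
  apply: (@choice _ _ (fun aj h => h \in ideal_pow I D /\
    val (c aj.1 aj.2) * rees_frac I b = rees_frac I h)) => -[a j] /=.
  have [|h hI hE] := Lb (c a j); last by exists h.
  rewrite mem_cat; apply/orP; right; apply/allpairsP; exists (a, j).
  by rewrite !mem_enum.
(* z_a = sum_j c_aj s_j, cleared of denominators, where z_a = x^(H a) / x_F. *)
have relation a : 'X_[H a] * (b * b) = 'X_[cmon F *+ 1] * \sum_j h (a, j) * g j.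
  apply: (@rees_frac_inj _ I); rewrite mulm1n -xmonE [LHS]rmorphM [RHS]rmorphM -cE.
  rewrite mulrAC mulrC; congr (_ * _).
  rewrite rmorph_sum mulr_suml rmorph_sum; apply: eq_bigr => j _.
  transitivity (rees_frac I (h (a, j)) * rees_frac I (g j)); last by rewrite -rmorphM.
  by rewrite -(hP (a, j)).2 -(gP j).2 !rmorphM; exact: mulrACA.
have g0 j : vertex_coef F D (g j) = 0.
  have sN : tnth s j \in nonunits (stalk P) by rewrite mE mem_ideal_gen // mem_tnth.
  have [gI gE] := gP j; apply/eqP; rewrite -(vertex_ideal_mono F gI).
  rewrite -(stalk_nonunitE (P := P) (z := tnth s j) (rees_mono_piece gI)
    (rees_mono_piece bI) bP) //.
  have b0 := rees_mono_notin_neq0 bP.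
  by rewrite rees_mono_frac // -gE mulfK // rees_frac_eq0.
pose B := vertex_coef F D b; have B0 : B != 0.
  by rewrite -(vertex_ideal_mono F bI).
pose U : 'M[k]_(r, d) := \matrix_(a, j) vertex_coef F D (h (a, j)).
pose V : 'M[k]_(d, r) := \matrix_(j, a) tangent_coef F (H a) D (g j).
(* Apply the derivation at [H a'] to [relation a]. As [x^(H a)] and the [g j] have vertex
   coefficient 0, one Leibniz term survives on each side, and an invertible scalar matrix factors
   through dimension [d]. *)
have UV : (B ^+ 2) *: 1%:M = U *m V.
  apply/matrixP => a a'; rewrite mxE mxE.
  have := congr1 (tangent_coef F (H a') (1 + (D + D))) (relation a).
  rewrite tangent_coefMX (tangent_coefM (Hirr a') (HI a) (ideal_powM bI bI)).
  rewrite (vertex_coefM hC FC bI bI) -/B {1}/vertex_coef mcoeffX mulm1n.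
  have [/eqP/negPf-> _] := Hirr a.
  rewrite mul0r add0r {1}/tangent_coef -mpolyXD mcoeffX mulm1n eqm_add2r (inj_eq Hinj).
  rewrite -expr2 mulrC => ->.
  rewrite [RHS]mxE tangent_coef_sum; apply: eq_bigr => j _.
  rewrite (tangent_coefM (Hirr a') (hP (a, j)).1 (gP j).1) g0 mulr0 addr0.
  by rewrite !mxE.
have := mxrankM_maxl U V; rewrite -UV mxrank_scale_nz ?expf_neq0 // mxrank1.
move/leq_trans; apply; exact: rank_leq_col.
Qed.

End IrreducibleBound.

(** * Tame clutters are complete partite *)

Section VertexCover.
Variables (k : fieldType) (n : nat) (C : {set {set 'I_n}}) (F : {set 'I_n}).
Hypotheses (hC : is_clutter C) (FC : F \in C).

Let gen (v : 'I_n) : 'X_{1..n} :=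
  if v \in F then (cmon F + U_(v))%MM else outer C F v.

Let gen_irr v : irr C F (gen v).
Proof.
by rewrite /gen; case: ifP => [|/negbT] vF; [exact: irr_inner | exact: irr_outer].
Qed.

Let genE v j : gen v j =
  ((j \in F) + (v == j) - ((v \notin F) && (j \in tmax C F v)))%N.
Proof.
rewrite /gen; case: ifP => vF /=; first by rewrite mnmDE mnmE mnm1E subn0.
by rewrite mnmBE mnmDE mnm1E !mnmE.
Qed.

Let gen_mon v : mon C 1 (gen v).
Proof.
have FU : mon C 1 (cmon F + U_(v))%MM.
  exists [:: F]; split=> //; first by move=> G; rewrite inE => /eqP->.
  by rewrite /cmon_sum big_seq1 lem_addr.
have [vF|vF] := boolP (v \in F); first by rewrite /gen vF.
have /andP[/subsetP TF /orP[/eqP T0|GC]] := tmax_admissible C F v.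
  rewrite /gen (negPf vF); have := outerK C F v; rewrite T0.
  suff -> : cmon set0 = 0%MM :> 'X_{1..n} by rewrite addm0 => ->.
  by apply/mnmP => j; rewrite mnmE inE mnm0E.
exists [:: v |: (F :\: tmax C F v)]; split=> //.
  by move=> G; rewrite inE => /eqP->.
rewrite /cmon_sum big_seq1; apply/mnm_lepP => j; rewrite genE mnmE !inE vF /=.
rewrite [j == v]eq_sym; case: eqP => [<-|_].
  by rewrite (negPf vF); case: (boolP (v \in tmax C F v)) => // /TF; rewrite (negPf vF).
by case: (j \in F); case: (j \in tmax C F v).
Qed.

Let gen_inj : injective gen.
Proof.
move=> i j /mnmP/(_ i); rewrite !genE eqxx eq_sym.
have /andP[/subsetP/(_ i) TF _] := tmax_admissible C F i.
by case: (i =P j) => // _; move: TF; case: (i \in F); case: (i \in tmax C F i) => //=;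
  try (by move=> /(_ isT)); case: (_ && _).
Qed.

(** An uncovered [u] makes [covdeg C F u] vanish at [G], so [irr_extra] gives an irreducible element
    where this form is 0. It is at least 1 on all [gen v], so there would be n + 1 irreducible
    elements. *)
Lemma vertex_cover : regular_local_ring (stalk (@vertex_point k n C F hC FC)) ->
  forall G, G \in C -> F :\: G \subset \bigcup_(v in G :\: F) tmax C F v.
Proof.
move=> reg G GC; apply/subsetP => u /setDP[uF uG]; apply/bigcupP.
apply: contrapT => nocov.
have G0 : covdeg C F u (cmon G) = 0%N.
  rewrite /covdeg mnmE (negPf uG) big1 // => v /andP[vF uv]; rewrite mnmE.
  have [vG|//] := boolP (v \in G); case: nocov; exists v => //.
  by rewrite inE vF.
have [G' G'C [G'0 G'irr]] := irr_extra hC FC uF GC G0.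
pose H (a : 'I_n.+1) := oapp gen (cmon G') (unlift ord_max a).
have genG' v : gen v <> cmon G'.
  move=> E; have := G'0; rewrite -E /gen; case: ifP => [vF|/negbT vF].
    by rewrite covdegD covdegF.
  by rewrite covdeg_outer.
have Hinj : injective H.
  move=> a b; rewrite /H; case: unliftP => [i ->|->]; case: unliftP => [j ->|->] //=.
  - by move/gen_inj->.
  - by move/genG'.
  - by move/esym/genG'.
have := irr_bound Hinj _ _ reg; rewrite ltnn => /(_ _ _)/negP; apply=> // a.
  by rewrite /H; case: (unlift _ _) => [v|] /=.
rewrite /H; case: (unlift _ _) => [v|] /=; first exact: gen_mon.
exists [:: G']; split=> //; first by move=> K; rewrite inE => /eqP->.
by rewrite /cmon_sum big_seq1 lepm_refl.
Qed.

End VertexCover.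

Section CoverCombinatorics.
Variables (n : nat) (C : {set {set 'I_n}}).
Hypothesis hC : is_clutter C.
Hypothesis covered : forall F G, F \in C -> G \in C ->
  F :\: G \subset \bigcup_(v in G :\: F) tmax C F v.

(** For nonempty [T], cover in the opposite direction: [v] lies in [tmax C G u] for some [u] in
    [F :\: G]. Exchanging it in [G] for [u] gives a circuit inside [F], hence equal to [F]; it
    contains no vertex of [T] except possibly [u]. *)
Lemma card_tmax F v : F \in C -> v \notin F -> (#|tmax C F v| <= 1)%N.
Proof.
move=> FC vF; have /andP[TF /orP[/eqP->|GC]] := tmax_admissible C F v.
  by rewrite cards0.
set T := tmax C F v in TF GC *; set G := v |: (F :\: T) in GC.
have [->|/set0Pn[w wT]] := eqVneq T set0; first by rewrite cards0.
have vGF : v \in G :\: F by rewrite !inE eqxx vF.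
have /bigcupP[u /setDP[uF uG] vT] := subsetP (covered GC FC) v vGF.
have /andP[_ /orP[/eqP T0|HC]] := tmax_admissible C G u; first by rewrite T0 inE in vT.
have HF : u |: (G :\: tmax C G u) = F.
  apply: hC => //; apply/subsetP => x; rewrite !inE => /predU1P[->//|/andP[xT]].
  by case/predU1P => [xv|/andP[]//]; rewrite xv vT in xT.
suff /subset_leq_card : T \subset [set u] by rewrite cards1.
apply/subsetP => x xT; have := subsetP TF x xT; rewrite -{1}HF !inE xT /=.
case/predU1P => [->//|/andP[_]]; rewrite orbF => /eqP xv.
by rewrite -xv (subsetP TF) // in vF.
Qed.

(** [g] fixes [F] and sends an outside [v] to the element of [tmax C F v]. Covering by sets of size
    at most one in both directions gives [G :\: F] and [F :\: G] equal size, so [g] is a bijection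
    between them. *)
Lemma circuit_exchange F : F \in C -> exists g : 'I_n -> 'I_n, forall G, G \in C ->
  [/\ {in G &, injective g}, g @: G = F
    & forall v, v \in G :\: F -> g v \in F /\ v |: (F :\ g v) \in C].
Proof.
move=> FC.
have card_le A B : A \in C -> B \in C -> (#|A :\: B| <= #|B :\: A|)%N.
  move=> hA hB; apply: leq_trans (subset_leq_card (covered hA hB)) _.
  rewrite -[X in (_ <= X)%N]sum1_card.
  elim/big_rec2: _ => [|v m U /setDP[_ vA] Um]; first by rewrite cards0.
  rewrite (leq_trans (leq_card_setU _ _)) // leq_add //; exact: card_tmax.
pose g v := if v \in F then v else odflt v [pick u in tmax C F v].
exists g => G GC.
have gE v u : v \notin F -> u \in tmax C F v -> g v = u.
  move=> vF uT; rewrite /g (negPf vF); case: pickP => [w wT|/(_ u)]; last by rewrite uT.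
  by have /card_le1_eqP := card_tmax FC vF; apply.
have sub : F :\: G \subset g @: (G :\: F).
  apply/subsetP => u /(subsetP (covered FC GC))/bigcupP[v vGF uT].
  by apply/imsetP; exists v => //; apply/esym/gE => //; case/setDP: vGF.
have cardE : #|g @: (G :\: F)| = #|G :\: F|.
  apply/eqP; rewrite eqn_leq leq_imset_card /=.
  exact: leq_trans (card_le _ _ GC FC) (subset_leq_card sub).
have imE : g @: (G :\: F) = F :\: G.
  by apply/esym/eqP; rewrite eqEcard sub cardE card_le.
have /imset_injP ginj : #|g @: (G :\: F)| == #|G :\: F| by rewrite cardE.
have gF v : v \in F -> g v = v by rewrite /g => ->.
have gGF v : v \in G -> v \notin F -> g v \in F :\: G.
  by move=> vG vF; rewrite -imE imset_f // inE vF.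
split.
- move=> x y xG yG; have [xF|xF] := boolP (x \in F); have [yF|yF] := boolP (y \in F).
  + by rewrite !gF.
  + by rewrite (gF x) // => E; have := gGF y yG yF; rewrite -E inE xG.
  + by rewrite (gF y) // => E; have := gGF x xG xF; rewrite E inE yG.
  + by apply: ginj; rewrite inE ?xF ?yF.
- rewrite -[in LHS](setID G F) imsetU imE.
  rewrite (_ : g @: (G :&: F) = F :&: G) ?setID //.
  rewrite setIC; apply/setP => x; apply/imsetP/idP => [[y yFG ->]|xFG].
    by rewrite gF //; case/setIP: yFG.
  by exists x => //; rewrite gF //; case/setIP: xFG.
move=> v /setDP[vG vF]; have gv := gGF v vG vF.
have /setDP[gvF _] := gv; split=> //.
move: gv; rewrite {1}/g (negPf vF); case: pickP => [u uT _|_ /=]; last first.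
  by rewrite inE vG.
have gu := gE v u vF uT; rewrite gu.
have /andP[_ /orP[/eqP T0|]] := tmax_admissible C F v; first by rewrite T0 inE in uT.
suff -> : tmax C F v = [set u] by [].
apply/eqP; rewrite eq_sym eqEcard sub1set uT cards1; exact: card_tmax.
Qed.

(** The blocks are the fibres of the exchange map [g] of one fixed circuit [F0]. A transversal [H]
    is reached from [F0] through circuits: each exchange brings in a vertex of [H] and removes one
    outside [H]. *)
Lemma covered_partite : C <> [set set0] ->
  exists d, (0 < d)%N /\ isolated_union_complete_dpartite d C.
Proof.
move=> C1; have [->|/set0Pn[F0 F0C]] := eqVneq C set0.
  exists 1%N; split=> //; exists set0; split; first by move=> F; rewrite inE.
  split; first by move=> F; rewrite inE.
  exists (fun=> set0); split.
  - split=> [i j _|]; first by rewrite disjoints_subset sub0set.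
    by apply: big1.
  - by move=> F; rewrite inE.
  - by move=> F; rewrite subset0 => /eqP->; rewrite cards0.
have F0n : F0 != set0.
  apply: contra_notN C1 => /eqP F00; apply/setP => G; rewrite inE.
  apply/idP/eqP => [GC|->]; last by rewrite -F00.
  by rewrite -F00; apply/esym/hC => //; rewrite F00 sub0set.
have [g gP] := circuit_exchange F0C.
have cardC G : G \in C -> #|G| = #|F0|.
  by move=> GC; have [ginj <- _] := gP G GC; rewrite card_in_imset.
exists #|F0|; split; first by rewrite card_gt0.
exists (cover C); have CW G : G \in C -> G \subset cover C.
  by move=> GC; apply: (bigcup_max G).
have gW v : v \in cover C -> g v \in F0.
  by move=> /bigcupP[G GC vG]; have [_ <- _] := gP G GC; apply: imset_f.
split=> //; split=> //.
exists (fun i => [set v in cover C | g v == enum_val i]); split.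
- split=> [i j ij|].
    rewrite -setI_eq0; apply/eqP/setP => v; rewrite !inE.
    apply/negP => /andP[/andP[_ /eqP gi] /andP[_ /eqP gj]].
    by case/eqP: ij; apply: enum_val_inj; rewrite -gi gj.
  apply/setP => v; apply/bigcupP/idP => [[i _]|vW]; first by rewrite inE => /andP[].
  exists (enum_rank_in (gW v vW) (g v)) => //.
  by rewrite inE vW enum_rankK_in ?eqxx ?gW.
- move=> G GC i; apply/card_le1_eqP => x y; rewrite !inE.
  move=> /and3P[xG _ /eqP gx] /and3P[yG _ /eqP gy].
  by have [ginj _ _] := gP G GC; apply: ginj => //; rewrite gx gy.
move=> H HW Hd Hone.
have Hinj : {in H &, injective g}.
  move=> x y xH yH gxy; have gx := gW x (subsetP HW x xH).
  have /card_le1_eqP := Hone (enum_rank_in gx (g x)); apply; rewrite !inE ?xH ?yH;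
    by rewrite (subsetP HW) //= enum_rankK_in // ?gxy eqxx.
suff ind m F : F \in C -> (#|H :\: F| <= m)%N -> H \in C by apply: (ind _ F0).
elim: m F => [|m IHm] F FC.
  rewrite leqn0 cards_eq0 setD_eq0 => HF.
  have -> // : H = F by apply/eqP; rewrite eqEcard HF Hd (cardC F FC) /=.
move=> HFm; have [HF0|/set0Pn[v vHF]] := eqVneq (H :\: F) set0.
  by apply: (IHm F) => //; rewrite HF0 cards0.
have [vH vF] := setDP vHF.
have /bigcupP[K KC vK] := subsetP HW v vH.
have [f fP] := circuit_exchange FC; have [_ _ /(_ v)] := fP K KC.
rewrite inE vF vK => /(_ isT)[]; set u := f v => uF F'C.
(* [g] maps both [F] and the circuit obtained from it by exchanging [u] for [v] bijectively onto
   [F0], so [u] and [v] share a block; as [H] meets it in [v], the vertex [u] is not in [H]. *)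
have guv : g u = g v.
  have [gF imF _] := gP F FC; have [gF' imF' _] := gP _ F'C.
  have : g v \in g @: F by rewrite imF gW // (subsetP HW).
  move=> /imsetP[w wF gvw]; have [wu|wu] := eqVneq w u; first by rewrite gvw wu.
  have vw : v = w by apply: gF' => //; rewrite !inE ?eqxx // wu wF orbT.
  by rewrite vw wF in vF.
have uH : u \notin H.
  by apply: contra vF => uH; rewrite (Hinj v u).
apply: (IHm _ F'C); rewrite -ltnS; apply: leq_trans HFm.
apply: proper_card; apply/properP; split; last first.
  by exists v; rewrite // !inE eqxx.
apply/subsetP => x /setDP[xH]; rewrite !inE negb_or negb_and negbK xH andbT.
by move=> /andP[_ /orP[/eqP xu|//]]; rewrite -xu xH in uH.
Qed.

End CoverCombinatorics.

Theorem theorem2p8 (k : closedFieldType) (n : nat) (C : {set {set 'I_n}})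
    (hC : is_clutter C) (hC0 : C <> [set set0]) :
  tame_clutter k C <->
  exists d : nat, (0 < d)%N /\ isolated_union_complete_dpartite d C.
Proof.
split=> [tame|[d [_ Cd]]]; last exact: partite_tame Cd.
apply: covered_partite => // F G FC GC.
exact: (@vertex_cover k n C F hC FC (tame (vertex_point k hC FC)) G GC).
Qed.
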